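(* Let $\lambda_1,\lambda_2,\mu_1,\mu_2>0$ and $\theta_s,\theta_d>0$. Consider the two-sided N-system matching queue with reneging, described by the continuous-time Markov chain with the states and transition rates given in the context, and let $\pi_{0,0}$, $\pi^L_{m,n}$, $\pi^R_{m,n}$, $q_{i,j}$ denote the steady state (stationary) probabilities of the empty state, of the states $L(m,n)$, of the states $R(m,n)$, and of the states $Q(i,j)$, respectively. Then the steady state probabilities are given by $$ q_{i,j}=\left(\prod_{k=1}^i\frac{\lambda_2}{\mu_2+k\theta_s}\right)\left(\prod_{k=1}^j\frac{\mu_1}{\lambda_1+k\theta_d}\right)B,\qquad i,j\ge1, $$ $$ \pi^L_{m,n}=\begin{cases} \left(\dfrac{\mu_1}{\mu_1+\mu_2+m\theta_s}\right)\left(\displaystyle\prod_{i=1}^m\frac{\lambda_2}{\mu_2+i\theta_s}\right)\left(\displaystyle\prod_{i=1}^n\frac{\lambda_1+\lambda_2}{\mu_1+\mu_2+m\theta_s+i\theta_s}\right)B, & m\ge1,\ n\ge0,\\[2ex] \left(\displaystyle\prod_{i=1}^n\frac{\lambda_1+\lambda_2}{\mu_1+\mu_2+i\theta_s}\right)B, & m=0,\ n>0, \end{cases} $$ $$ \pi^R_{m,n}=\begin{cases} \left(\dfrac{\lambda_2}{\lambda_1+\lambda_2+m\theta_d}\right)\left(\displaystyle\prod_{i=1}^m\frac{\mu_1}{\lambda_1+i\theta_d}\right)\left(\displaystyle\prod_{i=1}^n\frac{\mu_1+\mu_2}{\lambda_1+\lambda_2+m\theta_d+i\theta_d}\right)B,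 & m\ge1,\ n\ge0,\\[2ex] \left(\displaystyle\prod_{i=1}^n\frac{\mu_1+\mu_2}{\lambda_1+\lambda_2+i\theta_d}\right)B, & m=0,\ n>0, \end{cases} $$ where $B$ is a normalizing constant equal to $\pi_{0,0}$, the steady state probability of having an empty system.
   Context: **The two-sided N-system with reneging.** Flexible supply (type 1) and inflexible supply (type 2) arrive as independent Poisson processes with rates $\lambda_1$ and $\lambda_2$; type 1 and type 2 demand arrive as independent Poisson processes with rates $\mu_1$ and $\mu_2$. Flexible supply can be matched to type 1 or type 2 demand; inflexible supply can be matched only to type 2 demand. Matching is first-come first-served (FCFS): an arriving unit is immediately matched to the earliest-arrived compatible waiting unit of the other side; if there is none, it queues. Each waiting supply unit abandons (reneges) after an independent exponential time of rate $\theta_s$, and each waiting demand unit after an independent exponential time of rate $\theta_d$. Put $\gamma_s=\lambda_1/(\lambda_1+\lambda_2)$ (probability that an arriving supply unit is flexible) and $\gamma_d=\mu_2/(\mu_1+\mu_2)$ (probability that an arriving demand unit is of type 2). **States.** - The empty state $\emptyset$, also identified with $L(0,0)$ and $R(0,0)$ in the transitions below. - $L(m,n)$, with $m,n\in\mathbb{Z}_{\ge0}$, $m+n>0$: no demand is waiting; the supply queue in order of arrival consists of $m$ units known to be inflexible at the head, followed by $n$ units of unknown type (independently, each is flexible with probability $\gamma_s$). - $R(m,n)$, with $m,n\in\mathbb{Z}_{\ge0}$, $m+n>0$: no supply is waiting; the demand queue in order of arrival consists of $m$ units known to be of type 1 at the head, followed by $n$ units of unknown type (independently, each is of type 2 with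 probability $\gamma_d$). - $Q(i,j)$, with $i,j\ge1$: $i$ inflexible supply units and $j$ type 1 demand units are waiting, and nothing else (no feasible match exists). When an arriving unit is compatible with only one type of the waiting side, it scans the unknown units in order of arrival until it finds a compatible one; the scanned incompatible units join the known part. **Transition rates of the resulting continuous-time Markov chain** (rates to the same target state are added). From $\emptyset$: to $L(0,1)$ at rate $\lambda_1+\lambda_2$; to $R(0,1)$ at rate $\mu_1+\mu_2$. From $L(m,n)$, $m+n>0$: - to $L(m,n+1)$ at rate $\lambda_1+\lambda_2$; - to $L(m-1,n)$ at rate $\mu_2+m\theta_s$, if $m\ge1$; - to $L(0,n-1)$ at rate $\mu_2$, if $m=0$ (so $n\ge1$); - to $L(m,n-1)$ at rate $n\theta_s$, if $n\ge1$; - to $L(m+k,n-k-1)$ at rate $\mu_1\gamma_s(1-\gamma_s)^k$, for $0\le k\le n-1$; - to $Q(m+n,1)$ at rate $\mu_1(1-\gamma_s)^n$. From $R(m,n)$, $m+n>0$: - to $R(m,n+1)$ at rate $\mu_1+\mu_2$; - to $R(m-1,n)$ at rate $\lambda_1+m\theta_d$, if $m\ge1$; - to $R(0,n-1)$ at rate $\lambda_1$, if $m=0$ (so $n\ge1$); - to $R(m,n-1)$ at rate $n\theta_d$, if $n\ge1$; - to $R(m+k,n-k-1)$ at rate $\lambda_2\gamma_d(1-\gamma_d)^k$, for $0\le k\le n-1$; - to $Q(1,m+n)$ at rate $\lambda_2(1-\gamma_d)^n$. From $Q(i,j)$, $i,j\ge1$: - to $Q(i+1,j)$ at rate $\lambda_2$;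 to $Q(i,j+1)$ at rate $\mu_1$; - at rate $\mu_2+i\theta_s$: to $Q(i-1,j)$ if $i\ge2$, and to $R(j,0)$ if $i=1$; - at rate $\lambda_1+j\theta_d$: to $Q(i,j-1)$ if $j\ge2$, and to $L(i,0)$ if $j=1$. The steady state probabilities are the probability distribution on this state space satisfying the global balance (equilibrium) equations of the chain. Empty products equal $1$. *)

(* Defs.v *)
From HB Require Import structures.
From mathcomp Require Import all_boot all_order all_algebra.
From mathcomp Require Import classical_sets reals constructive_ereal esum.

Set Implicit Arguments.
Unset Strict Implicit.
Unset Printing Implicit Defensive.

Import Order.TTheory GRing.Theory Num.Theory.
Local Open Scope classical_set_scope.
Local Open Scope ring_scope.

(** Continuous-time Markov chains on a countable state space. The rates
    [q x x] are irrelevant. Both sides of a balance equation are (possibly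
    infinite) sums of terms that are nonnegative as soon as [p] and [q] are. *)

Definition probability_vector (R : realType) (T : choiceType) (p : T -> R)
    : Prop :=
  (forall x, 0 <= p x) /\ \esum_(x in [set: T]) (p x)%:E = 1%:E.

Definition global_balance (R : realType) (T : choiceType) (q : T -> T -> R)
    (p : T -> R) : Prop :=
  forall x, \esum_(y in [set~ x]) (p x * q x y)%:E =
            \esum_(y in [set~ x]) (p y * q y x)%:E.

Definition steady_state (R : realType) (T : choiceType) (q : T -> T -> R)
    (p : T -> R) : Prop :=
  probability_vector p /\ global_balance q p.

(** Symbols for the states; the state space is the subtype of [valid] ones. *)

Inductive symbol : Type :=
| SEmpty
| SL of nat & nat
| SR of nat & nat
| SQ of nat & nat.

Definition symbol_code (s : symbol) :
    (unit + nat * nat + (nat * nat + nat * nat))%type :=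
  match s with
  | SEmpty => inl (inl tt)
  | SL m n => inl (inr (m, n))
  | SR m n => inr (inl (m, n))
  | SQ i j => inr (inr (i, j))
  end.

Definition symbol_decode
    (c : (unit + nat * nat + (nat * nat + nat * nat))%type) : symbol :=
  match c with
  | inl (inl _) => SEmpty
  | inl (inr (m, n)) => SL m n
  | inr (inl (m, n)) => SR m n
  | inr (inr (i, j)) => SQ i j
  end.

Lemma symbol_codeK : cancel symbol_code symbol_decode.
Proof. by case. Qed.

HB.instance Definition _ := Countable.copy symbol (can_type symbol_codeK).

Definition valid (s : symbol) : bool :=
  match s with
  | SEmpty => true
  | SL m n => (0 < m + n)%N
  | SR m n => (0 < m + n)%N
  | SQ i j => (0 < i)%N && (0 < j)%N
  end.

Definition state : Type := {s : symbol | valid s}.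
HB.instance Definition _ := Countable.on state.

Definition stE : state := exist _ SEmpty isT.

(** By the default value of [insubd], [stL 0 0 = stR 0 0 = stE], which is the
    intended identification. [stQ i j] is only used for [i, j >= 1]. *)
Definition stL (m n : nat) : state := insubd stE (SL m n).
Definition stR (m n : nat) : state := insubd stE (SR m n).
Definition stQ (i j : nat) : state := insubd stE (SQ i j).

(** [l1], [l2]: arrival rates of flexible and inflexible supply; [m1], [m2]:
    arrival rates of type 1 and type 2 demand; [ts], [td]: reneging rates of
    supply and demand units. Each list enumerates the possible transitions as
    (target, rate) pairs, in which a target may occur several times. *)

Definition gamma_s (R : realType) (l1 l2 : R) : R := l1 / (l1 + l2).
Definition gamma_d (R : realType) (m1 m2 : R) : R := m2 / (m1 + m2).

Definition transE (R : realType) (l1 l2 m1 m2 : R) : seq (state * R) :=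
  [:: (stL 0 1, l1 + l2); (stR 0 1, m1 + m2)].

Definition transL (R : realType) (l1 l2 m1 m2 ts : R) (m n : nat) :
    seq (state * R) :=
  let g := gamma_s l1 l2 in
  [:: (stL m n.+1, l1 + l2)]
  ++ (if (0 < m)%N then [:: (stL m.-1 n, m2 + m%:R * ts)]
      else [:: (stL 0 n.-1, m2)])
  ++ (if (0 < n)%N then [:: (stL m n.-1, n%:R * ts)] else [::])
  ++ [seq (stL (m + k) (n - k - 1), m1 * g * (1 - g) ^+ k) | k <- iota 0 n]
  ++ [:: (stQ (m + n) 1, m1 * (1 - g) ^+ n)].

Definition transR (R : realType) (l1 l2 m1 m2 td : R) (m n : nat) :
    seq (state * R) :=
  let g := gamma_d m1 m2 in
  [:: (stR m n.+1, m1 + m2)]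
  ++ (if (0 < m)%N then [:: (stR m.-1 n, l1 + m%:R * td)]
      else [:: (stR 0 n.-1, l1)])
  ++ (if (0 < n)%N then [:: (stR m n.-1, n%:R * td)] else [::])
  ++ [seq (stR (m + k) (n - k - 1), l2 * g * (1 - g) ^+ k) | k <- iota 0 n]
  ++ [:: (stQ 1 (m + n), l2 * (1 - g) ^+ n)].

Definition transQ (R : realType) (l1 l2 m1 m2 ts td : R) (i j : nat) :
    seq (state * R) :=
  [:: (stQ i.+1 j, l2); (stQ i j.+1, m1);
      (if (2 <= i)%N then stQ i.-1 j else stR j 0, m2 + i%:R * ts);
      (if (2 <= j)%N then stQ i j.-1 else stL i 0, l1 + j%:R * td)].

Definition transitions (R : realType) (l1 l2 m1 m2 ts td : R) (x : state) :
    seq (state * R) :=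
  match val x with
  | SEmpty => transE l1 l2 m1 m2
  | SL m n => transL l1 l2 m1 m2 ts m n
  | SR m n => transR l1 l2 m1 m2 td m n
  | SQ i j => transQ l1 l2 m1 m2 ts td i j
  end.

Definition rate (R : realType) (l1 l2 m1 m2 ts td : R) (x y : state) : R :=
  \sum_(t <- transitions l1 l2 m1 m2 ts td x | t.1 == y) t.2.

(* Main.v *)
Require Import Defs.
From mathcomp Require Import all_boot all_order all_algebra.
From mathcomp Require Import boolp classical_sets fsbigop reals.
From mathcomp Require Import constructive_ereal ereal esum.
From mathcomp Require Import topology normedtype sequences.
From mathcomp Require Import ring lra zify.

Set Implicit Arguments.
Unset Strict Implicit.
Unset Printing Implicit Defensive.

Import Order.TTheory GRing.Theory Num.Theory.
Local Open Scope classical_set_scope.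
Local Open Scope ring_scope.

(** The stated weights, with [B = 1], solve the balance equations. For the
    scanning transitions this rests on the identity [side_scan]: along the
    states with a fixed number [m + n] of waiting units on one side, the
    weights times the powers of the probability of the incompatible type add
    up to a single product, by induction on [m].

    Transition rates are unbounded, so existence of this solution does not by
    itself exclude other solutions of the balance equations. But its weights
    decay factorially while the total rates out of the states grow linearly, so
    the total flow is finite, and a truncation argument then shows that every
    nonnegative solution is proportional to it. *)

(** * Balance equations of an irreducible chain *)

(** [rate] is given by rows, as finite lists of targets, whereas inflows need columns. [sources]
    therefore lists each column explicitly, and both infinite sums of a balance equation collapse to
    finite list sums. Supply and demand are mirror images, so the queue computations are done once,
    for abstract families [st] and [qt], and used twice. No global equation is checked in one piece;
    each splits into partial balances. At a state with one waiting side, the inflow by arrivals on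
    that side (from [stQ] if there is no unknown unit) balances all outflow except that at the
    arrival rate [lam]; the latter is balanced by the inflow from services, reneging and scans. At
    [stQ i j] the outflows at the four rates are balanced separately, and at [stE] the two arrival
    flows. *)

Lemma esum_le_eq (R : realType) (T : choiceType) (D : set T)
    (f g : T -> \bar R) :
  (forall x, D x -> (0 <= f x <= g x)%E) ->
  (\esum_(x in D) f x < +oo)%E ->
  (\esum_(x in D) g x <= \esum_(x in D) f x)%E ->
  forall x, D x -> f x = g x.
Proof.
move=> fg fin gf x Dx.
have f0 y : D y -> (0 <= f y)%E by move/fg => /andP[].
have g0 y : D y -> (0 <= g y)%E by move/fg => /andP[/le_trans]; apply.
have sub1 : D `&` [set x] = [set x] by apply: setIidr => y ->.
(* The sum of [g] away from [x] is finite, so it can be added to both sides of the inequality at [x]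
   and cancelled. *)
have rest_fin : (\esum_(y in D `&` ~` [set x]) g y)%E \is a fin_num.
  rewrite ge0_fin_numE; last by apply: esum_ge0 => y [/g0].
  apply: le_lt_trans (le_lt_trans gf fin).
  by rewrite [leRHS](esumID [set x])// sub1 esum_set1 ?g0// leeDr ?g0.
apply/eqP; rewrite eq_le (andP (fg _ Dx)).2/= -(leeD2rE _ _ rest_fin).
have : (g x + \esum_(y in D `&` ~` [set x]) g y <=
        f x + \esum_(y in D `&` ~` [set x]) f y)%E.
  move: gf; rewrite (esumID [set x])// [X in (_ <= X)%E](esumID [set x])//.
  by rewrite sub1 !esum_set1 ?f0 ?g0.
move=> /le_trans; apply; rewrite leeD2l//.
by apply: le_esum => y [/fg /andP[]].
Qed.

Lemma esumZl (R : realType) (T : choiceType) (D : set T) (c : R)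
    (f : T -> \bar R) :
  0 <= c -> (forall x, 0 <= f x)%E ->
  (\esum_(x in D) (c%:E * f x) = c%:E * \esum_(x in D) f x)%E.
Proof.
move=> c0 f0; rewrite /esum -ereal_supZl//; last first.
  by apply/set0P; exists 0%E, set0; [exact: fsets_set0|rewrite fsbig_set0].
rewrite image_comp; congr ereal_sup; apply: eq_imagel => A _ /=.
by rewrite ge0_mule_fsumr.
Qed.

(** Tonelli over the off-diagonal pairs, a set stable under swapping coordinates. Applied to the
    flows [w x * q x y], it equates total outflow and total inflow. *)
Lemma esum_swap_neq (R : realType) (T : choiceType) (f : T -> T -> \bar R) :
  (forall x y, 0 <= f x y)%E ->
  (\esum_(x in [set: T]) \esum_(y in [set~ x]) f x y =
   \esum_(x in [set: T]) \esum_(y in [set~ x]) f y x)%E.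
Proof.
move=> f0; rewrite !esum_esum//.
pose D := [set: T] `*`` (fun x => [set~ x]).
rewrite (reindex_esum D D (fun z : T * T => (z.2, z.1)))//; split => /=.
- by move=> [x y] /= [_ xy]; split => // yx; apply: xy.
- by move=> [x y] [x' y'] _ _ [-> ->].
- by move=> [x y] /= [_ xy]; exists (y, x) => //=; split => // yx; apply: xy.
Qed.

(** Paths run from the indexed state to [x0]. Equality of two solutions propagates in this
    orientation: from [y] to its predecessors [x], which contribute to the inflow at [y]. *)
Inductive leads_to (R : realType) (T : choiceType) (q : T -> T -> R) (x0 : T) :
    T -> Prop :=
| leads_to_refl : leads_to q x0 x0
| leads_to_step x y : y != x -> 0 < q x y -> leads_to q x0 y ->
    leads_to q x0 x.

Section Uniqueness.
Variables (R : realType) (T : choiceType) (q : T -> T -> R).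
Hypothesis q_ge0 : forall x y, 0 <= q x y.

Let outflow (p : T -> R) x := (\esum_(y in [set~ x]) (p x * q x y)%:E)%E.
Let inflow (p : T -> R) x := (\esum_(y in [set~ x]) (p y * q y x)%:E)%E.

Let inflow_le p r x : (forall y, p y <= r y) -> (inflow p x <= inflow r x)%E.
Proof.
by move=> pr; apply: le_esum => y _; rewrite lee_fin ler_wpM2r.
Qed.

Let outflow_le p r x : (forall y, p y <= r y) -> (outflow p x <= outflow r x)%E.
Proof.
by move=> pr; apply: le_esum => y _; rewrite lee_fin ler_wpM2r.
Qed.

(** Where the solutions agree, their outflows and hence their inflows agree. These inflows are
    finite and ordered termwise, so they agree term by term, and a positive [q x y] carries equality
    from [y] to [x]. *)
Let eq_solution p r x0 : (forall x, 0 <= p x <= r x) ->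
  global_balance q p -> global_balance q r ->
  (forall x, outflow p x < +oo)%E ->
  (forall x, leads_to q x0 x) -> p x0 = r x0 -> p =1 r.
Proof.
move=> pr balp balr fin lead eq0 x; elim: (lead x) => // {}x y yx qxy _ eqy.
have yx' : [set~ y] x by move=> /= xy; rewrite xy eqxx in yx.
have in_r : (inflow r y <= inflow p y)%E.
  by rewrite /inflow -(balr y) -(balp y) eqy.
have in_p : (inflow p y < +oo)%E by rewrite /inflow -(balp y) fin.
have le_in z : [set~ y] z -> (0 <= (p z * q z y)%:E <= (r z * q z y)%:E)%E.
  by move=> _; have /andP[p0 pr0] := pr z; rewrite !lee_fin mulr_ge0//= ler_wpM2r.
have [] := esum_le_eq le_in in_p in_r yx'.
exact: (mulIf (lt0r_neq0 qxy)).
Qed.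

(* For every [c >= 0] the minimum [w] of [p] and [c * u] satisfies
   [inflow w <= outflow w]. Both sides have the same finite total, hence [w]
   satisfies the balance equations; taking [c] such that [p] and [c * u] agree
   at [x0] forces [p = w = c * u]. *)
Lemma global_balance_proportional (u p : T -> R) (x0 : T) :
  (forall x, 0 < u x) -> global_balance q u ->
  (\esum_(x in [set: T]) \esum_(y in [set~ x]) (u x * q x y)%:E < +oo)%E ->
  (forall x, leads_to q x0 x) ->
  (forall x, 0 <= p x) -> global_balance q p ->
  forall x, p x = p x0 / u x0 * u x.
Proof.
move=> u_gt0 balu fin lead p0 balp.
pose c := p x0 / u x0; pose cu x := c * u x.
have c0 : 0 <= c by rewrite divr_ge0// ltW.
have cu0 x : 0 <= cu x by rewrite mulr_ge0// ltW.
have uq0 x y z : (0 <= (u x * q y z)%:E)%E by rewrite lee_fin mulr_ge0// ltW.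
have outcu x : (outflow cu x = c%:E * outflow u x)%E.
  by rewrite -esumZl//; apply: eq_esum => y _; rewrite -EFinM mulrA.
have balcu : global_balance q cu.
  move=> x; rewrite -/(outflow cu x) outcu /outflow balu -esumZl//.
  by apply: eq_esum => y _; rewrite -EFinM mulrA.
pose w x := Num.min (p x) (cu x).
have wp x : w x <= p x by rewrite ge_min lexx.
have wcu x : w x <= cu x by rewrite ge_min lexx orbT.
have w0 x : 0 <= w x by rewrite le_min p0 cu0.
have out0 x : (0 <= outflow w x)%E.
  by apply: esum_ge0 => y _; rewrite lee_fin mulr_ge0.
have finw : (\esum_(x in [set: T]) outflow w x < +oo)%E.
  apply: (@le_lt_trans _ _ (\esum_(x in [set: T]) outflow cu x)%E).
    by apply: le_esum => x _; exact: outflow_le.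
  under eq_esum do rewrite outcu.
  rewrite esumZl//; last by move=> x; exact: esum_ge0.
  by rewrite lte_mul_pinfty.
(* The outflow at [x] sees only the value at [x]. So [w] has there the outflow of one of the two
   solutions, which equals the inflow of that solution and dominates the inflow of [w]. *)
have in_out x : (inflow w x <= outflow w x)%E.
  have [wE|wE] : w x = p x \/ w x = cu x.
    by rewrite /w /Num.min; case: ifP; [left|right].
  - by rewrite [leRHS]/outflow wE balp; exact: inflow_le.
  - by rewrite [leRHS]/outflow wE balcu; exact: inflow_le.
have totE : (\esum_(x in [set: T]) outflow w x =
             \esum_(x in [set: T]) inflow w x)%E.
  by rewrite esum_swap_neq// => x y; rewrite lee_fin mulr_ge0.
have balw : global_balance q w.
  move=> x; apply/esym; apply: (@esum_le_eq _ _ [set: T] (inflow w) (outflow w));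
    rewrite -?totE//.
  move=> y _; rewrite in_out andbT; apply: esum_ge0 => z _.
  by rewrite lee_fin mulr_ge0.
have finwx x : (outflow w x < +oo)%E.
  apply: le_lt_trans finw; rewrite (esumID [set x])// setTI esum_set1// leeDl//.
  exact: esum_ge0.
have cu_x0 : cu x0 = p x0 by rewrite /cu divfK// gt_eqF.
have w_x0 : w x0 = p x0 by rewrite /w cu_x0 minxx.
move=> x.
rewrite -(eq_solution _ balw balp finwx lead w_x0); last by move=> y; rewrite w0 wp.
rewrite (eq_solution _ balw balcu finwx lead) ?w_x0//.
by move=> y; rewrite w0 wcu.
Qed.
End Uniqueness.

(** * States and transitions of the N-system *)

(** Each entry is counted at exactly one [y], its own tag, which lies in the domain because it
    differs from [x]. A constant [p] gives outflows, a varying one inflows. *)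
Lemma esum_tagged (R : realType) (T : choiceType) (p : T -> R) (x : T)
    (s : seq (T * R)) :
  (forall y, 0 <= p y) -> (forall t, t \in s -> t.1 != x /\ 0 <= t.2) ->
  \esum_(y in [set~ x]) (p y * \sum_(t <- s | t.1 == y) t.2)%:E =
  (\sum_(t <- s) p t.1 * t.2)%:E.
Proof.
move=> p0 sx.
transitivity (\esum_(y in [set~ x])
    \sum_(t <- s | t \in s) (if t.1 == y then p y * t.2 else 0)%:E)%E.
  apply: eq_esum => y _; rewrite -big_seq sumEFin; congr EFin.
  by rewrite mulr_sumr [LHS]big_mkcond.
rewrite esum_sum; last first.
  by move=> y t _ /sx[_ t0]; case: ifP => // _; rewrite lee_fin mulr_ge0.
rewrite -sumEFin [RHS]big_seq; apply: eq_bigr => t /sx[tx t0].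
have tx' : [set~ x] t.1 by move=> /= /eqP; exact/negP.
rewrite (esumID [set t.1]); last first.
  by move=> y _; case: ifP => // _; rewrite lee_fin mulr_ge0.
rewrite setIidr; last by move=> y ->.
rewrite esum_set1 eqxx ?lee_fin ?mulr_ge0// esum1 ?adde0//.
by move=> y [_ /= yt]; case: eqP => // ty; case: yt.
Qed.

Lemma symbol_eqE :
  ((forall m n a b, (SL m n == SL a b) = (m == a) && (n == b)) *
   (forall m n a b, (SR m n == SR a b) = (m == a) && (n == b)) *
   (forall m n a b, (SQ m n == SQ a b) = (m == a) && (n == b)) *
   (forall m n, (SEmpty == SL m n) = false) *
   (forall m n, (SL m n == SEmpty) = false) *
   (forall m n, (SEmpty == SR m n) = false) *
   (forall m n, (SR m n == SEmpty) = false) *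
   (forall m n, (SEmpty == SQ m n) = false) *
   (forall m n, (SQ m n == SEmpty) = false) *
   (forall m n a b, (SL m n == SR a b) = false) *
   (forall m n a b, (SR m n == SL a b) = false) *
   (forall m n a b, (SL m n == SQ a b) = false) *
   (forall m n a b, (SQ m n == SL a b) = false) *
   (forall m n a b, (SR m n == SQ a b) = false) *
   (forall m n a b, (SQ m n == SR a b) = false))%type.
Proof. by do !split. Qed.

Lemma val_stL m n : (0 < m + n)%N -> val (stL m n) = SL m n.
Proof. by move=> mn; rewrite val_insubd /= ifT. Qed.

Lemma val_stR m n : (0 < m + n)%N -> val (stR m n) = SR m n.
Proof. by move=> mn; rewrite val_insubd /= ifT. Qed.

Lemma val_stQ i j : (0 < i)%N -> (0 < j)%N -> val (stQ i j) = SQ i j.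
Proof. by move=> i0 j0; rewrite val_insubd /= ifT ?i0. Qed.

Lemma stL00 : stL 0 0 = stE. Proof. by apply: val_inj; rewrite val_insubd. Qed.
Lemma stR00 : stR 0 0 = stE. Proof. by apply: val_inj; rewrite val_insubd. Qed.

Lemma state_case (P : state -> Prop) :
  P stE -> (forall m n, (0 < m + n)%N -> P (stL m n)) ->
  (forall m n, (0 < m + n)%N -> P (stR m n)) ->
  (forall i j, P (stQ i.+1 j.+1)) -> forall x, P x.
Proof.
move=> PE PL PR PQ [[|m n|m n|[|i] [|j]] //= v].
- by rewrite (_ : exist _ _ _ = stE)//; exact: val_inj.
- rewrite (_ : exist _ _ _ = stL m n)//; first exact: PL.
  by apply: val_inj; rewrite val_stL.
- rewrite (_ : exist _ _ _ = stR m n)//; first exact: PR.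
  by apply: val_inj; rewrite val_stR.
- by rewrite (_ : exist _ _ _ = stQ i.+1 j.+1)//; apply: val_inj; rewrite val_stQ.
Qed.

(** Injectivity extends to (0,0): it is the only pair falling to the default [stE]. *)
Lemma stL_eq m n a b : (stL m n == stL a b) = (m == a) && (n == b).
Proof.
rewrite -val_eqE !val_insubd /=.
by case: m n a b => [|m] [|n] [|a] [|b]; rewrite /= ?symbol_eqE// ?addn0 ?symbol_eqE.
Qed.

Lemma stR_eq m n a b : (stR m n == stR a b) = (m == a) && (n == b).
Proof.
rewrite -val_eqE !val_insubd /=.
by case: m n a b => [|m] [|n] [|a] [|b]; rewrite /= ?symbol_eqE// ?addn0 ?symbol_eqE.
Qed.

Lemma stQ_eq i j a b : (stQ i.+1 j.+1 == stQ a.+1 b.+1) = (i == a) && (j == b).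
Proof. by rewrite -val_eqE !val_insubd /= symbol_eqE !eqSS. Qed.

Lemma stLR_eq m n a b : (stL m n == stR a b) = (m + n + a + b == 0)%N.
Proof.
rewrite -val_eqE !val_insubd /=.
by case: m n a b => [|m] [|n] [|a] [|b]; rewrite /= ?symbol_eqE// ?addn0 ?symbol_eqE.
Qed.

Lemma stLQ_eq m n a b : (stL m n == stQ a.+1 b.+1) = false.
Proof. by rewrite -val_eqE !val_insubd /=; case: ifP; rewrite symbol_eqE. Qed.

Lemma stRQ_eq m n a b : (stR m n == stQ a.+1 b.+1) = false.
Proof. by rewrite -val_eqE !val_insubd /=; case: ifP; rewrite symbol_eqE. Qed.

(** A scan reaches a given target for at most one number [k0] of skipped units, and for none unless
    [c] holds. *)
Lemma sum_iota_unique (R : realType) (P : pred nat) (F : nat -> R) n k0 c :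
  (forall k, (k < n)%N -> P k = c && (k == k0)) -> (c -> k0 < n)%N ->
  \sum_(k <- iota 0 n | P k) F k = if c then F k0 else 0.
Proof.
move=> Pc cn; rewrite -{1}[n]subn0 -/(index_iota 0 n).
transitivity (\sum_(0 <= k < n | c && (k == k0)) F k).
  rewrite big_nat_cond [RHS]big_nat_cond; apply: eq_bigl => k.
  by have [/Pc->|] := boolP (k < n)%N; rewrite ?andbF.
case: c {Pc} cn => [cn|_]; last by rewrite big_pred0.
by rewrite big_nat1_eq /= cn.
Qed.

Lemma sum_tag0 (R : realType) (T : eqType) (s : seq (T * R)) (x : T) :
  (forall t, t \in s -> t.1 != x) -> \sum_(t <- s | t.1 == x) t.2 = 0.
Proof.
move=> sx; rewrite big_seq_cond big_pred0// => t.
by apply/andP => -[/sx/negPf ->].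
Qed.

Lemma sum_tag1 (R : realType) (T : eqType) (x y : T) (r : R) :
  \sum_(t <- [:: (x, r)] | t.1 == y) t.2 = if x == y then r else 0.
Proof. by rewrite big_cons big_nil /= addr0. Qed.

Lemma sum_tag_cons (R : realType) (T : eqType) (x : T) (r : R)
    (s : seq (T * R)) (y : T) :
  \sum_(t <- (x, r) :: s | t.1 == y) t.2 =
  (if x == y then r else 0) + \sum_(t <- s | t.1 == y) t.2.
Proof. by rewrite big_cons /=; case: ifP => _; rewrite ?add0r. Qed.

Lemma sum_tag_cat (R : realType) (T : eqType) (r s : seq (T * R)) (x : T) :
  \sum_(t <- r ++ s | t.1 == x) t.2 =
  \sum_(t <- r | t.1 == x) t.2 + \sum_(t <- s | t.1 == x) t.2.
Proof. exact: big_cat. Qed.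

Lemma sum_tag_map (R : realType) (I T : eqType) (f : I -> T) (F : I -> R)
    (s : seq I) (x : T) :
  \sum_(t <- [seq (f i, F i) | i <- s] | t.1 == x) t.2 =
  \sum_(i <- s | f i == x) F i.
Proof. by rewrite big_map. Qed.

(** * Transitions of a queue with one waiting side, by origin and by target *)

Section OneSide.
Variables (R : realType) (st qt : nat -> nat -> state) (lam a b g s : R).
Hypothesis st_eq : forall m n m' n', (st m n == st m' n') = (m == m') && (n == n').
Hypothesis qt_eq : forall i j i' j',
  (qt i.+1 j.+1 == qt i'.+1 j'.+1) = (i == i') && (j == j').
Hypothesis st_qt : forall m n i j, (st m n == qt i.+1 j.+1) = false.

(* [transL] is the instance [st = stL], [qt = stQ], and [transR] the instance
   [st = stR], [qt i j = stQ j i]. The waiting side is joined at rate [lam] and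
   reneges at rate [s] per unit; the other side sends units that match any type
   at rate [b], and choosy ones at rate [a], for which an unknown unit is
   compatible with probability [g]. *)
Definition side_transitions (m n : nat) : seq (state * R) :=
  [:: (st m n.+1, lam)]
  ++ (if (0 < m)%N then [:: (st m.-1 n, b + m%:R * s)] else [:: (st 0 n.-1, b)])
  ++ (if (0 < n)%N then [:: (st m n.-1, n%:R * s)] else [::])
  ++ [seq (st (m + k) (n - k - 1), a * g * (1 - g) ^+ k) | k <- iota 0 n]
  ++ [:: (qt (m + n) 1, a * (1 - g) ^+ n)].

(* The transitions into [st m n] other than arrivals on the waiting side and
   transitions from [qt], listed as (origin, rate) pairs. *)
Definition side_departures (m n : nat) : seq (state * R) :=
  [:: (st m.+1 n, b + m.+1%:R * s)]
  ++ (if m == 0%N then [:: (st 0 n.+1, b)] else [::])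
  ++ [:: (st m n.+1, n.+1%:R * s)]
  ++ [seq (st (m - k) (n + k + 1), a * g * (1 - g) ^+ k) | k <- iota 0 m.+1].

(** The groups of the two lists correspond: arrival, service of the head, reneging of an unknown
    unit, scan. The entry into [qt] does not count, that family being disjoint from [st]. *)
Lemma side_rate_eq m n m' n' : (0 < m + n)%N ->
  \sum_(t <- side_transitions m n | t.1 == st m' n') t.2 =
  \sum_(t <- (if (0 < n')%N then [:: (st m' n'.-1, lam)] else [::]) ++
             side_departures m' n' | t.1 == st m n) t.2.
Proof.
move=> mn0; rewrite /side_transitions /side_departures !sum_tag_cat !sum_tag_map.
have qtF : (qt (m + n) 1 == st m' n') = false.
  by rewrite eq_sym -(prednK mn0) st_qt.
have arrival : \sum_(t <- [:: (st m n.+1, lam)] | t.1 == st m' n') t.2 =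
    \sum_(t <- (if (0 < n')%N then [:: (st m' n'.-1, lam)] else [::]) |
      t.1 == st m n) t.2.
  rewrite sum_tag1 st_eq; case: n' {qtF} => [|n']; rewrite ?big_nil ?andbF//=.
  by rewrite sum_tag1 st_eq eqSS eq_sym (eq_sym n).
(* The target [st 0 n'] has two origins here: [st 1 n'], losing its known head, and [st 0 n'.+1],
   whose head is unknown. *)
have head : \sum_(t <- (if (0 < m)%N then [:: (st m.-1 n, b + m%:R * s)]
      else [:: (st 0 n.-1, b)]) | t.1 == st m' n') t.2 =
    \sum_(t <- [:: (st m'.+1 n', b + m'.+1%:R * s)] | t.1 == st m n) t.2 +
    \sum_(t <- (if m' == 0%N then [:: (st 0 n'.+1, b)] else [::]) |
      t.1 == st m n) t.2.
  case: m mn0 {qtF arrival} => [|m] mn0 /=.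
    rewrite !sum_tag1 !st_eq /= add0r; case: m' => [|m'] /=; last by rewrite big_nil.
    by rewrite sum_tag1 st_eq; case: n mn0 => //= n _; rewrite eqSS eq_sym.
  rewrite [X in _ = _ + X](_ : _ = 0) ?addr0.
    rewrite !sum_tag1 !st_eq eqSS eq_sym (eq_sym n').
    by case: eqP => // ->.
  by case: m' => [|m'] /=; rewrite ?big_nil ?sum_tag1 ?st_eq.
have renege : \sum_(t <- (if (0 < n)%N then [:: (st m n.-1, n%:R * s)]
      else [::]) | t.1 == st m' n') t.2 =
    \sum_(t <- [:: (st m' n'.+1, n'.+1%:R * s)] | t.1 == st m n) t.2.
  rewrite sum_tag1 st_eq; case: n {mn0 qtF arrival head} => [|n] /=.
    by rewrite big_nil andbF.
  rewrite sum_tag1 st_eq eqSS eq_sym (eq_sym n'); case: eqP => //= _.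
  by case: eqP => // ->.
have scan : \sum_(k <- iota 0 n | st (m + k) (n - k - 1) == st m' n')
      a * g * (1 - g) ^+ k =
    \sum_(k <- iota 0 m'.+1 | st (m' - k) (n' + k + 1) == st m n)
      a * g * (1 - g) ^+ k.
  under eq_bigl do rewrite st_eq; under [in RHS]eq_bigl do rewrite st_eq.
  (* The number of skipped units is forced to be [m' - m], and exactly one unit leaves. *)
  pose c := (m <= m')%N && (m + n == m' + n' + 1)%N.
  by rewrite !(@sum_iota_unique _ _ _ _ (m' - m)%N c)// => *; rewrite /c; lia.
by rewrite arrival head renege scan !sum_tag1 qtF addr0 !addrA.
Qed.

Lemma side_rate_qt m n i j : (0 < m + n)%N ->
  \sum_(t <- side_transitions m n | t.1 == qt i.+1 j.+1) t.2 =
  if (j == 0%N) && (m + n == i.+1)%N then a * (1 - g) ^+ n else 0.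
Proof.
move=> mn0; rewrite /side_transitions !sum_tag_cat sum_tag_map !sum_tag1 st_qt.
rewrite [X in _ + (_ + (_ + (X + _)))]big_pred0; last by move=> k; rewrite st_qt.
rewrite !sum_tag0 ?add0r; first last.
- by move=> t; case: ifP => _; rewrite inE => /eqP->; rewrite st_qt.
- by move=> t; case: ifP => _ //; rewrite inE => /eqP->; rewrite st_qt.
by rewrite -(prednK mn0) qt_eq andbC eqSS [0%N == _]eq_sym.
Qed.

Lemma side_rate0 m n x : (0 < m + n)%N ->
  (forall m' n', st m' n' != x) -> (forall i, qt i.+1 1 != x) ->
  \sum_(t <- side_transitions m n | t.1 == x) t.2 = 0.
Proof.
move=> mn0 stx qtx; apply: sum_tag0 => t.
rewrite /side_transitions !mem_cat ?mem_seq1.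
case/or4P => [/eqP->|||/orP[/mapP[k _ ->]|/eqP->]] /=; rewrite ?stx//.
- by case: ifP => _; rewrite mem_seq1 => /eqP-> /=.
- by case: ifP => _ //; rewrite mem_seq1 => /eqP-> /=.
- by rewrite -(prednK mn0).
Qed.

Lemma side_departures0 m n x : (forall m' n', (0 < m' + n')%N -> st m' n' != x) ->
  \sum_(t <- side_departures m n | t.1 == x) t.2 = 0.
Proof.
move=> stx; apply: sum_tag0 => t.
rewrite /side_departures !mem_cat ?mem_seq1.
case/or4P => [/eqP->||/eqP->|/mapP[k _ ->]]; try by apply: stx; lia.
by case: ifP => _ //; rewrite inE => /eqP->; exact: stx.
Qed.

(* The (origin, rate) pairs of the transitions from [st] into [qt i 1]. *)
Definition side_blocks (i : nat) : seq (state * R) :=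
  [seq (st (i - k) k, a * (1 - g) ^+ k) | k <- iota 0 i.+1].

Lemma side_blocksE i m n :
  \sum_(t <- side_blocks i | t.1 == st m n) t.2 =
  if (m + n == i)%N then a * (1 - g) ^+ n else 0.
Proof.
rewrite sum_tag_map; under eq_bigl do rewrite st_eq.
by rewrite (@sum_iota_unique _ _ _ _ n (m + n == i)%N)//; lia.
Qed.

Lemma side_blocks0 i x : (forall m n, (m + n)%N = i -> st m n != x) ->
  \sum_(t <- side_blocks i | t.1 == x) t.2 = 0.
Proof.
move=> stx; apply: sum_tag0 => t /mapP[k]; rewrite mem_iota => /andP[_ ki] ->.
by apply: stx; lia.
Qed.

(** A choosy arrival is matched after some number of skips or finds nobody; these probabilities add
    up to 1, so the total depends on [m + n] only. *)
Lemma side_total_rate m n :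
  \sum_(t <- side_transitions m n) t.2 = lam + a + b + (m + n)%:R * s.
Proof.
have scan k : \sum_(i <- iota 0 k) a * g * (1 - g) ^+ i + a * (1 - g) ^+ k = a.
  rewrite -(subn0 k) -/(index_iota 0 k) subn0.
  elim: k => [|k IH]; first by rewrite big_nil add0r expr0 mulr1.
  by rewrite big_nat_recr//= -[RHS]IH exprS -!addrA; congr (_ + _); ring.
rewrite /side_transitions !big_cat /= big_map /= big_seq1 big_seq1 /= scan.
by case: m n => [|m] [|n] /=; rewrite ?big_seq1 ?big_nil /= ?natrD; ring.
Qed.

Lemma side_transitions_valid m n : 0 <= lam -> 0 <= a -> 0 <= b -> 0 <= s ->
  0 <= g <= 1 -> (0 < m + n)%N ->
  forall t, t \in side_transitions m n -> t.1 != st m n /\ 0 <= t.2.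
Proof.
move=> lam0 a0 b0 s0 /andP[g0 g1] mn0 t.
have g10 k : 0 <= (1 - g) ^+ k by rewrite exprn_ge0// subr_ge0.
rewrite /side_transitions !mem_cat ?mem_seq1.
case/or4P => [/eqP->|||/orP[/mapP[k /[!mem_iota] kn ->]|/eqP->]] /=.
- by rewrite st_eq; split => //; lia.
- case: ifP => m0; rewrite inE => /eqP-> /=; rewrite st_eq; split; try lia;
    by rewrite ?addr_ge0// mulr_ge0.
- case: ifP => n0 //; rewrite inE => /eqP-> /=; rewrite st_eq; split; first lia.
  by rewrite mulr_ge0.
- rewrite st_eq; split; first lia.
  by rewrite !mulr_ge0.
- by rewrite eq_sym -(prednK mn0) st_qt mulr_ge0.
Qed.

Lemma side_departures_valid m n : 0 <= a -> 0 <= b -> 0 <= s -> 0 <= g <= 1 ->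
  forall t, t \in side_departures m n -> t.1 != st m n /\ 0 <= t.2.
Proof.
move=> a0 b0 s0 /andP[g0 g1] t.
have g10 k : 0 <= (1 - g) ^+ k by rewrite exprn_ge0// subr_ge0.
rewrite /side_departures !mem_cat ?mem_seq1.
case/or4P => [/eqP->||/eqP->|/mapP[k /[!mem_iota] kn ->]] /=.
- rewrite st_eq; split; first lia; by rewrite addr_ge0// mulr_ge0.
- by case: ifP => // m0; rewrite inE => /eqP-> /=; rewrite st_eq; split => //; lia.
- rewrite st_eq; split; first lia; by rewrite mulr_ge0.
- by rewrite st_eq !mulr_ge0//; split => //; lia.
Qed.
End OneSide.

(** * Product weights *)

Definition rate_prod (R : realType) (lam b s : R) (n : nat) : R :=
  \prod_(1 <= i < n.+1) (lam / (b + i%:R * s)).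

(** [c] is the arrival rate of the incompatible type on the waiting side, [lam] the total arrival
    rate there. At [m = 0] the first factor is 1 instead of [a / (a + b)], which gives (0,0) the
    weight of the empty state. *)
Definition side_weight (R : realType) (lam a b c s : R) (m n : nat) : R :=
  (if m == 0%N then 1 else a / (a + b + m%:R * s)) * rate_prod c b s m *
  rate_prod lam (a + b + m%:R * s) s n.

Section Weights.
Variables (R : realType) (lam a b c s : R).
Hypotheses (lam0 : 0 < lam) (a0 : 0 < a) (b0 : 0 < b) (c0 : 0 < c) (s0 : 0 < s).

Lemma rate_prod0 (x y : R) : rate_prod x y s 0 = 1.
Proof. by rewrite /rate_prod big_geq. Qed.

Lemma rate_prodS (x y : R) n :
  rate_prod x y s n.+1 = rate_prod x y s n * (x / (y + n.+1%:R * s)).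
Proof. by rewrite /rate_prod big_nat_recr. Qed.

Lemma rate_prodSl (x y : R) n :
  rate_prod x y s n.+1 = x / (y + s) * rate_prod x (y + s) s n.
Proof.
rewrite /rate_prod big_nat_recl// mul1r; congr (_ * _).
by apply: eq_bigr => i _; rewrite -natr1; congr (_ / _); ring.
Qed.

Lemma rate_prod_gt0 (x y : R) n : 0 < x -> 0 < y -> 0 < rate_prod x y s n.
Proof.
move=> x0 y0; apply: prodr_gt0 => i _.
by rewrite divr_gt0// ltr_wpDr// mulr_ge0// ltW.
Qed.

Lemma den_gt0 (y : R) k : 0 < y -> 0 < y + k%:R * s.
Proof. by move=> y0; rewrite ltr_wpDr// mulr_ge0// ltW. Qed.

Let W := side_weight lam a b c s.
Let P := rate_prod c b s.
Let D m n := rate_prod lam (a + b + m%:R * s) s n.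

Lemma side_weight_gt0 m n : 0 < W m n.
Proof.
have ab0 : 0 < a + b by rewrite addr_gt0.
by rewrite !mulr_gt0 ?rate_prod_gt0 ?den_gt0//; case: ifP => // _;
  rewrite divr_gt0 ?den_gt0.
Qed.

Lemma side_weight0 n : W 0 n = D 0 n.
Proof. by rewrite /W /side_weight eqxx rate_prod0 !mul1r. Qed.

Lemma side_weight_pos m n :
  W m.+1 n = a / (a + b + m.+1%:R * s) * P m.+1 * D m.+1 n.
Proof. by []. Qed.

(** Partial balance at [st m n.+1]: inflow by arrivals against all outflow other than arrivals. It
    expresses the last factor of the product over unknown units. *)
Lemma side_weightS m n :
  W m n.+1 * (a + b + (m + n.+1)%:R * s) = lam * W m n.
Proof.
have ab : 0 < a + b by rewrite addr_gt0.
have := den_gt0 (m + n.+1) ab; rewrite /W /side_weight rate_prodS.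
rewrite (_ : a + b + m%:R * s + n.+1%:R * s = a + b + (m + n.+1)%:R * s); last first.
  by rewrite natrD; ring.
by move: (a + b + _) => d /lt0r_neq0 d0; field.
Qed.

(** Peeling off the first factor shifts the base by [s], which amounts to raising [m] by one. *)
Lemma rate_prod_shift m n : D m n.+1 = lam / (a + b + m.+1%:R * s) * D m.+1 n.
Proof.
by rewrite /D rate_prodSl (_ : _ + s = a + b + m.+1%:R * s)// -[in RHS]natr1; ring.
Qed.

Lemma side_scan m n :
  \sum_(0 <= k < m.+1) W (m - k) (n + k) * (c / lam) ^+ k = P m * D m n.
Proof.
have ab : 0 < a + b by rewrite addr_gt0.
elim: m n => [|m IH] n.
  by rewrite big_nat1 expr0 mulr1 addn0 side_weight0 /P rate_prod0 mul1r.
rewrite big_nat_recl// expr0 mulr1 subn0 addn0.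
under eq_bigr => k _ do rewrite subSS addnS -addSn exprS mulrCA.
(* The terms with k >= 1 are [c / lam] times the sum for [m] and [n.+1]. After the shift they form
   the share [(b + m.+1%:R * s) / (a + b + m.+1%:R * s)] of the right-hand side; the term k = 0 is
   the complementary share, with numerator [a]. *)
rewrite -mulr_sumr IH side_weight_pos rate_prod_shift /P rate_prodS.
have /lt0r_neq0 := den_gt0 m.+1 ab; have /lt0r_neq0 := den_gt0 m.+1 b0.
rewrite -[a + b + _]addrA; move: (b + _) => d d0 ad0.
by field; rewrite ad0 d0 gt_eqF.
Qed.

(** The other partial balance: outflow by arrivals against inflow by services, reneging and scans.
    [side_scan] at [n.+1] sums the scans; then all terms are multiples of [D m.+1 n], and a rational
    identity in [l = lam - c] remains. *)
Lemma side_balance l m n : lam = l + c ->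
  lam * W m n = W m.+1 n * (b + m.+1%:R * s) +
    (if m == 0%N then W 0 n.+1 * b else 0) +
    W m n.+1 * (n.+1%:R * s) +
    \sum_(0 <= k < m.+1) W (m - k) (n + k + 1) * (a * (l / lam) * (c / lam) ^+ k).
Proof.
move=> lamE; have lE : l = lam - c by rewrite lamE addrK.
have ab : 0 < a + b by rewrite addr_gt0.
under eq_bigr => k _ do rewrite mulrCA addnAC.
rewrite -mulr_sumr side_scan -side_weightS side_weight_pos addn1 rate_prod_shift.
rewrite /P rate_prodS.
have /lt0r_neq0 := den_gt0 m.+1 ab; have /lt0r_neq0 := den_gt0 m.+1 b0.
case: m => [|m].
  rewrite eqxx side_weight0 rate_prod_shift /P !rate_prod0 natrD.
  rewrite -[a + b + 1%:R * s]addrA.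
  move: (b + _) (D 1 n) => d x d0 ad0; rewrite lE.
  by field; rewrite ad0 d0 gt_eqF.
have /lt0r_neq0 := den_gt0 m.+1 ab.
rewrite side_weight_pos rate_prod_shift -[a + b + m.+2%:R * s]addrA.
have -> : a + b + (m.+1 + n.+1)%:R * s = a + b + m.+1%:R * s + n.+1%:R * s.
  by rewrite natrD mulrDl addrA.
move: (a + b + _) (D m.+2 n) => e x e0.
move: (b + _) => d d0 ad0; rewrite lE /P /= addr0.
by field; rewrite e0 ad0 d0 gt_eqF.
Qed.
End Weights.

Section Balance.
Variables (R : realType) (lam a b c s l : R).
Hypotheses (lam0 : 0 < lam) (a0 : 0 < a) (b0 : 0 < b) (c0 : 0 < c) (s0 : 0 < s).
Hypothesis lamE : lam = l + c.
Variables (st : nat -> nat -> state) (p : state -> R).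
Hypothesis pE : forall m n, p (st m n) = side_weight lam a b c s m n.

Let compl : 1 - l / lam = c / lam.
Proof. by rewrite lamE; field; rewrite -lamE gt_eqF. Qed.

Lemma side_departures_balance m n :
  \sum_(t <- side_departures st a b (l / lam) s m n) p t.1 * t.2 =
  lam * side_weight lam a b c s m n.
Proof.
rewrite (side_balance lam0 a0 b0 s0 m n lamE) /side_departures !big_cat big_map /=.
rewrite !big_seq1 /= !pE !addrA; congr (_ + _ + _ + _).
  by case: ifP => _; rewrite ?big_nil// big_seq1 /= pE.
rewrite -/(iota 0 m.+1) -[iota _ _]/(index_iota 0 m.+1).
by apply: eq_bigr => k _; rewrite pE compl.
Qed.

(** This is [side_scan] at [n = 0]: the states with [i] units on one side jointly feed [qt i 1] as a
    fictitious [qt i 0] of weight [rate_prod c b s i] would. *)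
Lemma side_blocks_balance i :
  \sum_(t <- side_blocks st a (l / lam) i) p t.1 * t.2 = a * rate_prod c b s i.
Proof.
have := @side_scan _ lam a b c s lam0 a0 b0 s0 i 0; rewrite rate_prod0 mulr1 => <-.
rewrite /side_blocks big_map mulr_sumr -[iota _ _]/(index_iota 0 i.+1).
by apply: eq_bigr => k _ /=; rewrite pE compl mulrCA.
Qed.
End Balance.

(** * Summability *)

Lemma esum_exp_coeff_lty (R : realType) (z : R) : 0 <= z ->
  (\esum_(n in [set: nat]) (exp_coeff z n)%:E < +oo)%E.
Proof.
move=> z0; rewrite -nneseries_esumT; last first.
  by move=> n; rewrite lee_fin exp_coeff_ge0.
rewrite (_ : (fun n => _) = EFin \o series (exp_coeff z)); last first.
  by apply/funext => n; rewrite /= sumEFin.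
by rewrite EFin_lim ?ltry//; exact: is_cvg_series_exp_coeff.
Qed.

Lemma esum_prod_lty (R : realType) (I J : choiceType) (f : I -> R) (g : J -> R) :
  (forall i, 0 <= f i) -> (forall j, 0 <= g j) ->
  (\esum_(i in [set: I]) (f i)%:E < +oo)%E ->
  (\esum_(j in [set: J]) (g j)%:E < +oo)%E ->
  (\esum_(k in [set: I * J]) (f k.1 * g k.2)%:E < +oo)%E.
Proof.
move=> f0 g0 ffin gfin.
have fE0 i : (0 <= (f i)%:E)%E by rewrite lee_fin.
have gE0 j : (0 <= (g j)%:E)%E by rewrite lee_fin.
have := @esum_esum R I J [set: I] (fun=> [set: J]) (fun i j => (f i * g j)%:E).
rewrite (_ : _ `*`` _ = setT); last by apply/seteqP; split.
move=> <-; last by move=> *; rewrite lee_fin mulr_ge0.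
under eq_esum => i _ do rewrite (esumZl _ (f0 i) gE0) muleC.
rewrite (_ : (\esum_(j in [set: J]) (g j)%:E)%E =
    (fine (\esum_(j in [set: J]) (g j)%:E)%E)%:E); last first.
  by rewrite fineK// ge0_fin_numE// esum_ge0.
rewrite esumZl//; last by rewrite fine_ge0// esum_ge0.
by rewrite lte_mul_pinfty// ?lee_fin ?fine_ge0 ?esum_ge0.
Qed.

Lemma le_esum_inj (R : realType) (T U : choiceType) (h : T -> U)
    (f : T -> \bar R) (g : U -> \bar R) :
  injective h -> (forall x, (0 <= g x)%E) -> (forall x, (f x <= g (h x))%E) ->
  (\esum_(x in [set: T]) f x <= \esum_(u in [set: U]) g u)%E.
Proof.
move=> hI g0 fg; apply: (le_trans (le_esum (fun x _ => fg x))).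
rewrite -(esum_image setT h) => [|x y _ _ /hI//].
by rewrite [leRHS](esumID (range h))// setTI leeDl// esum_ge0.
Qed.

(** Dropping [b] from the denominators bounds the factor of index [i] by [z / i%:R]. *)
Lemma rate_prod_le (R : realType) (lam b s z : R) n :
  0 <= lam -> 0 < b -> 0 < s -> lam / s <= z ->
  rate_prod lam b s n <= exp_coeff z n.
Proof.
move=> lam0 b0 s0 lamz; elim: n => [|n IH].
  by rewrite rate_prod0 /exp_coeff /= expr0 fact0 divr1.
have z0 : 0 <= z by apply: le_trans lamz; rewrite divr_ge0// ltW.
have ns0 : 0 < n.+1%:R * s by rewrite mulr_gt0.
have -> : exp_coeff z n.+1 = exp_coeff z n * (z / n.+1%:R).
  rewrite /exp_coeff /= exprSr factS natrM invfM.
  by rewrite [_^-1 / _]mulrC mulrACA.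
rewrite rate_prodS ler_pM//.
- rewrite /rate_prod; apply: prodr_ge0 => i _.
  by rewrite divr_ge0// addr_ge0 ?mulr_ge0// ltW.
- by rewrite divr_ge0// addr_ge0// ltW.
- apply: (@le_trans _ _ (lam / (n.+1%:R * s))).
    by rewrite ler_wpM2l// lef_pV2 ?posrE ?addr_gt0// lerDr ltW.
  by rewrite invfM mulrCA mulrC ler_wpM2r// invr_ge0.
Qed.

(** * The N-system *)

Section NSystem.
Variables (R : realType) (l1 l2 m1 m2 ts td : R).
Hypotheses (hl1 : 0 < l1) (hl2 : 0 < l2) (hm1 : 0 < m1) (hm2 : 0 < m2).
Hypotheses (hts : 0 < ts) (htd : 0 < td).

Let gs := gamma_s l1 l2.
Let gd := gamma_d m1 m2.
Notation stQ' := (fun i j => stQ j i).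
Notation trans := (transitions l1 l2 m1 m2 ts td).
Notation rate := (rate l1 l2 m1 m2 ts td).

(** * Rows and columns of the rate matrix *)

Lemma transitionsL m n : (0 < m + n)%N -> trans (stL m n) =
  side_transitions stL stQ (l1 + l2) m1 m2 gs ts m n.
Proof. by move=> mn0; rewrite /transitions val_stL. Qed.

Lemma transitionsR m n : (0 < m + n)%N -> trans (stR m n) =
  side_transitions stR stQ' (m1 + m2) l2 l1 gd td m n.
Proof. by move=> mn0; rewrite /transitions val_stR. Qed.

Lemma transitionsQ i j : trans (stQ i.+1 j.+1) = transQ l1 l2 m1 m2 ts td i.+1 j.+1.
Proof. by rewrite /transitions val_stQ. Qed.

(* The (origin, rate) pairs of all transitions into [x]. *)
Definition sources (x : state) : seq (state * R) :=
  match val x with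
  | SEmpty => side_departures stL m1 m2 gs ts 0 0 ++
              side_departures stR l2 l1 gd td 0 0
  | SL m n => (if (0 < n)%N then [:: (stL m n.-1, l1 + l2)]
               else [:: (stQ m 1, l1 + td)])
              ++ side_departures stL m1 m2 gs ts m n
  | SR m n => (if (0 < n)%N then [:: (stR m n.-1, m1 + m2)]
               else [:: (stQ 1 m, m2 + ts)])
              ++ side_departures stR l2 l1 gd td m n
  | SQ i j => (if (1 < i)%N then [:: (stQ i.-1 j, l2)] else [::])
              ++ (if (1 < j)%N then [:: (stQ i j.-1, m1)] else [::])
              ++ [:: (stQ i.+1 j, m2 + i.+1%:R * ts)]
              ++ [:: (stQ i j.+1, l1 + j.+1%:R * td)]
              ++ (if j == 1%N then side_blocks stL m1 gs i else [::])
              ++ (if i == 1%N then side_blocks stR l2 gd j else [::])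
  end.

Lemma sourcesE : sources stE =
  side_departures stL m1 m2 gs ts 0 0 ++ side_departures stR l2 l1 gd td 0 0.
Proof. by []. Qed.

Let stLQ := stLQ_eq.
Let stRQ m n i j : (stR m n == stQ' i.+1 j.+1) = false.
Proof. exact: stRQ_eq. Qed.
Let stQ'_eq i j i' j' :
  (stQ' i.+1 j.+1 == stQ' i'.+1 j'.+1) = (i == i') && (j == j').
Proof. by rewrite stQ_eq andbC. Qed.
Let stRL m n a b : (stR m n == stL a b) = (m + n + a + b == 0)%N.
Proof. by rewrite eq_sym stLR_eq; congr (_ == _); lia. Qed.
Let stQL i j m n : (stQ i.+1 j.+1 == stL m n) = false.
Proof. by rewrite eq_sym stLQ_eq. Qed.
Let stQR i j m n : (stQ i.+1 j.+1 == stR m n) = false.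
Proof. by rewrite eq_sym stRQ_eq. Qed.

(** [stE] is both [stL 0 0] and [stR 0 0], so departures of both sides lead into it; for an origin
    on one side the list of the other side contributes nothing. *)
Lemma rate_into_E y :
  rate y stE = \sum_(t <- sources stE | t.1 == y) t.2.
Proof.
rewrite sourcesE sum_tag_cat /rate.
elim/state_case: y => [|m n mn0|m n mn0|i j].
- rewrite !side_departures0 ?addr0.
  + by apply: sum_tag0 => t; rewrite !inE => /orP[]/eqP-> /=;
      rewrite -?stL00 ?stL_eq ?stRL.
  + by move=> m n mn0; rewrite -stR00 stR_eq; lia.
  + by move=> m n mn0; rewrite -stL00 stL_eq; lia.
- rewrite transitionsL// -stL00 (side_rate_eq _ _ _ _ _ stL_eq stLQ)// cat0s.
  by rewrite [X in _ + X]side_departures0 ?addr0// => a b ab0; rewrite stRL; lia.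
- rewrite transitionsR// -stR00 (side_rate_eq _ _ _ _ _ stR_eq stRQ)// cat0s.
  by rewrite [X in X + _]side_departures0 ?add0r// => a b ab0; rewrite stLR_eq; lia.
- rewrite !side_departures0 ?addr0; first last.
  + by move=> a b ab0; rewrite stLQ_eq.
  + by move=> a b ab0; rewrite stRQ_eq.
  rewrite transitionsQ /transQ; apply: sum_tag0 => t.
  rewrite !inE -stL00 => /or4P[]/eqP-> /=; rewrite ?stQL//.
    by case: i => [|i] /=; rewrite ?stQL ?stRL; lia.
  by case: j => [|j] /=; rewrite ?stQL ?stL_eq; lia.
Qed.

(** Origins outside the family: [stE], read as [stL 0 0], for the target [stL 0 1]; and [stQ m 1],
    losing its last demand unit, for [stL m 0]. *)
Lemma rate_into_L m n y : (0 < m + n)%N ->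
  rate y (stL m n) = \sum_(t <- sources (stL m n) | t.1 == y) t.2.
Proof.
move=> mn0; rewrite /sources val_stL// sum_tag_cat /rate.
elim/state_case: y => [|a b ab0|a b ab0|i j].
- rewrite side_departures0; last by move=> a b ab0; rewrite -stL00 stL_eq; lia.
  have RL : (stR 0 1 == stL m n) = false by rewrite stRL; lia.
  rewrite /transitions /transE !big_cons big_nil /= RL -stL00 stL_eq addr0.
  case: n mn0 {RL} => [|n] mn0 /=; rewrite sum_tag1.
    by rewrite andbF eq_sym -(prednK (n := m)) ?stLQ ?addr0//; lia.
  by rewrite stL_eq eqSS eq_sym [0%N == n]eq_sym addr0.
- rewrite transitionsL// (side_rate_eq _ _ _ _ _ stL_eq stLQ)// sum_tag_cat.
  congr (_ + _); case: n mn0 => //= n0; rewrite big_nil sum_tag1 eq_sym.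
  by rewrite -(prednK (n := m)) ?stLQ//; lia.
- rewrite side_departures0 ?addr0; last by move=> c d cd0; rewrite stLR_eq; lia.
  rewrite transitionsR// (side_rate0 _ _ _ _ _ ab0) => [|c d|k].
  + case: n mn0 => [|n] mn0 /=; rewrite sum_tag1 ?stLR_eq.
      by rewrite -(prednK (n := m)) ?stQR//; lia.
    by rewrite ifF//; lia.
  + by rewrite stRL; lia.
  + by rewrite stQL.
- rewrite side_departures0 ?addr0; last by move=> c d cd0; rewrite stLQ.
  rewrite transitionsQ /transQ !big_cons big_nil /= !stQL addr0.
  have -> : ((if (2 <= i.+1)%N then stQ i j.+1 else stR j.+1 0) == stL m n) = false.
    by case: i => [|i] /=; rewrite ?stQL ?stRL; lia.
  case: j => [|j] /=; last first.
    rewrite stQL; case: n mn0 => [|n] mn0 /=; rewrite sum_tag1 ?stLQ//.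
    by rewrite -(prednK (n := m)) ?stQ_eq ?andbF//; lia.
  rewrite stL_eq; case: n mn0 => [|n] mn0 /=; rewrite sum_tag1 ?stLQ ?andbF//.
  rewrite -(prednK (n := m)) ?stQ_eq ?andbT; last lia.
  by rewrite mul1r eqSS eq_sym.
Qed.

Lemma rate_into_R m n y : (0 < m + n)%N ->
  rate y (stR m n) = \sum_(t <- sources (stR m n) | t.1 == y) t.2.
Proof.
move=> mn0; rewrite /sources val_stR// sum_tag_cat /rate.
elim/state_case: y => [|a b ab0|a b ab0|i j].
- rewrite side_departures0; last by move=> a b ab0; rewrite -stR00 stR_eq; lia.
  have LR : (stL 0 1 == stR m n) = false by rewrite stLR_eq; lia.
  rewrite /transitions /transE !big_cons big_nil /= LR -stR00 stR_eq addr0.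
  case: n mn0 {LR} => [|n] mn0 /=; rewrite sum_tag1.
    by rewrite andbF eq_sym -(prednK (n := m)) ?stRQ ?addr0//; lia.
  by rewrite stR_eq eqSS eq_sym [0%N == n]eq_sym !addr0.
- rewrite side_departures0 ?addr0; last by move=> c d cd0; rewrite stRL; lia.
  rewrite transitionsL// (side_rate0 _ _ _ _ _ ab0) => [|c d|k].
  + case: n mn0 => [|n] mn0 /=; rewrite sum_tag1 ?stRL.
      by rewrite -(prednK (n := m)) ?stQL//; lia.
    by rewrite ifF//; lia.
  + by rewrite stLR_eq; lia.
  + by rewrite stQR.
- rewrite transitionsR// (side_rate_eq _ _ _ _ _ stR_eq stRQ)// sum_tag_cat.
  congr (_ + _); case: n mn0 => //= n0; rewrite big_nil sum_tag1 eq_sym.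
  by rewrite -(prednK (n := m)) ?stRQ//; lia.
- rewrite side_departures0 ?addr0; last by move=> c d cd0; rewrite stRQ.
  rewrite transitionsQ /transQ !big_cons big_nil /= !stQR addr0.
  have -> : ((if (2 <= j.+1)%N then stQ i.+1 j else stL i.+1 0) == stR m n) = false.
    by case: j => [|j] /=; rewrite ?stQR ?stLR_eq; lia.
  case: i => [|i] /=; last first.
    rewrite stQR; case: n mn0 => [|n] mn0 /=; rewrite sum_tag1 ?stRQ//.
    by rewrite -(prednK (n := m)) ?stQ_eq ?andbF//; lia.
  rewrite stR_eq; case: n mn0 => [|n] mn0 /=; rewrite sum_tag1 ?stRQ ?andbF//.
  rewrite -(prednK (n := m)) ?stQ_eq ?andbT; last lia.
  by rewrite mul1r addr0 eqSS eq_sym.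
Qed.

Lemma rate_into_Q i j y :
  rate y (stQ i.+1 j.+1) = \sum_(t <- sources (stQ i.+1 j.+1) | t.1 == y) t.2.
Proof.
have tagif (c : bool) (x : state) (s : seq (state * R)) :
    \sum_(t <- (if c then s else [::]) | t.1 == x) t.2 =
    if c then \sum_(t <- s | t.1 == x) t.2 else 0.
  by case: c; rewrite ?big_nil.
rewrite /sources val_stQ// !sum_tag_cat /rate !tagif !sum_tag1.
elim/state_case: y => [|a b ab0|a b ab0|i' j'].
- rewrite [LHS]sum_tag0; last first.
    by move=> t; rewrite !inE => /orP[]/eqP->; rewrite ?stLQ ?stRQ_eq.
  rewrite !side_blocks0 => [|m n mn|m n mn].
  + rewrite -stL00 !stQL; case: i => [|i]; case: j => [|j] /=; rewrite ?stQL;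
    by rewrite !addr0.
  + by rewrite -stR00 stR_eq; lia.
  + by rewrite -stL00 stL_eq; lia.
- rewrite transitionsL// (side_rate_qt _ _ _ _ _ stQ_eq stLQ)//.
  rewrite (side_blocksE _ _ stL_eq) side_blocks0; last first.
    by move=> m n mn; rewrite stRL; lia.
  rewrite !stQL; case: i => [|i]; case: j => [|j] /=; rewrite ?stQL;
    by rewrite ?if_same ?add0r ?addr0.
- rewrite transitionsR// (side_rate_qt _ _ _ _ _ stQ'_eq stRQ)//.
  rewrite (side_blocksE _ _ stR_eq) side_blocks0; last first.
    by move=> m n mn; rewrite stLR_eq; lia.
  rewrite !stQR; case: i => [|i]; case: j => [|j] /=; rewrite ?stQR;
    by rewrite ?if_same ?add0r ?addr0.
- rewrite !side_blocks0 => [|m n mn|m n mn]; last 2 first.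
  + by rewrite stRQ_eq.
  + by rewrite stLQ.
  rewrite transitionsQ /transQ !sum_tag_cons big_nil !if_same !addr0.
  congr (_ + (_ + (_ + _))).
  + case: i => [|i] /=; rewrite stQ_eq; first by [].
    by rewrite stQ_eq eqSS eq_sym [j' == j]eq_sym.
  + case: j => [|j] /=; rewrite stQ_eq; first by rewrite andbF.
    by rewrite stQ_eq eqSS eq_sym [j' == j]eq_sym.
  + case: i' => [|i'] /=; rewrite !stQ_eq ?stRQ_eq//.
    by rewrite eqSS [i' == i]eq_sym [j' == j]eq_sym; case: eqP => //= ->.
  + case: j' => [|j'] /=; rewrite !stQ_eq ?stLQ ?andbF//.
    rewrite eqSS [i' == i]eq_sym; case: eqP => //= _.
    by rewrite eq_sym; case: eqP => // ->.
Qed.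

Let gs01 : 0 <= gs <= 1.
Proof.
rewrite /gs /gamma_s; apply/andP; split; first by rewrite divr_ge0 ?addr_ge0 ?ltW.
by rewrite ler_pdivrMr ?addr_gt0// mul1r lerDl ltW.
Qed.
Let gd01 : 0 <= gd <= 1.
Proof.
rewrite /gd /gamma_d; apply/andP; split; first by rewrite divr_ge0 ?addr_ge0 ?ltW.
by rewrite ler_pdivrMr ?addr_gt0// mul1r lerDr ltW.
Qed.
Let sum_ge0 (x y : R) : 0 < x -> 0 < y -> 0 <= x + y.
Proof. by move=> *; rewrite addr_ge0 ?ltW. Qed.

Lemma rate_sources x y : rate y x = \sum_(t <- sources x | t.1 == y) t.2.
Proof.
elim/state_case: x => [|m n|m n|i j].
- exact: rate_into_E.
- exact: rate_into_L.
- exact: rate_into_R.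
- exact: rate_into_Q.
Qed.

(** Absence of self-loops matters because the balance sums omit the diagonal, while list sums run
    over all entries. *)
Lemma transitions_valid x t : t \in trans x -> t.1 != x /\ 0 <= t.2.
Proof.
elim/state_case: x => [|m n mn0|m n mn0|i j].
- rewrite !inE => /orP[]/eqP-> /=; split; rewrite ?sum_ge0//.
    by rewrite -stL00 stL_eq.
  by rewrite -stR00 stR_eq.
- rewrite transitionsL//.
  by apply: (side_transitions_valid stL_eq stLQ) => //; rewrite ?sum_ge0 ?ltW.
- rewrite transitionsR//.
  by apply: (side_transitions_valid stR_eq stRQ) => //; rewrite ?sum_ge0 ?ltW.
- rewrite transitionsQ /transQ !inE => /or4P[]/eqP-> /=.
  + by rewrite stQ_eq ltW//; split => //; lia.
  + by rewrite stQ_eq ltW//; split => //; lia.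
  + rewrite sum_ge0 ?mulr_gt0 ?ltr0n//; split => //.
    by case: i => [|i]; rewrite ?stRQ_eq// stQ_eq; lia.
  + rewrite sum_ge0 ?mulr_gt0 ?ltr0n//; split => //.
    by case: j => [|j]; rewrite ?stLQ// stQ_eq; lia.
Qed.

Lemma sources_valid x t : t \in sources x -> t.1 != x /\ 0 <= t.2.
Proof.
elim/state_case: x => [|m n mn0|m n mn0|i j].
- rewrite sourcesE mem_cat => /orP[]; rewrite -?stL00 -?stR00.
    by apply: (side_departures_valid stL_eq) => //; rewrite ltW.
  by rewrite stL00 -stR00; apply: (side_departures_valid stR_eq) => //; rewrite ltW.
- rewrite /sources val_stL// mem_cat => /orP[|].
    case: n mn0 => [|n] mn0; rewrite mem_seq1 => /eqP-> /=.
      by rewrite eq_sym -(prednK (n := m)) ?stLQ ?sum_ge0//; lia.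
    by rewrite stL_eq sum_ge0//; split => //; lia.
  by apply: (side_departures_valid stL_eq) => //; rewrite ltW.
- rewrite /sources val_stR// mem_cat => /orP[|].
    case: n mn0 => [|n] mn0; rewrite mem_seq1 => /eqP-> /=.
      by rewrite eq_sym -(prednK (n := m)) ?stRQ_eq ?sum_ge0//; lia.
    by rewrite stR_eq sum_ge0//; split => //; lia.
  by apply: (side_departures_valid stR_eq) => //; rewrite ltW.
- have [/andP[gs0 gs1] /andP[gd0 gd1]] := (gs01, gd01).
  rewrite /sources val_stQ// !mem_cat !mem_seq1.
  case/or4P => [||/eqP->|/or3P[/eqP->||]] /=.
  + case: ifP => // i1; rewrite mem_seq1 => /eqP-> /=; rewrite ltW//; split => //.
    by rewrite -(prednK (n := i)) ?stQ_eq; lia.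
  + case: ifP => // j1; rewrite mem_seq1 => /eqP-> /=; rewrite ltW//; split => //.
    by rewrite -(prednK (n := j)) ?stQ_eq; lia.
  + by rewrite stQ_eq sum_ge0 ?mulr_gt0 ?ltr0n//; split => //; lia.
  + by rewrite stQ_eq sum_ge0 ?mulr_gt0 ?ltr0n//; split => //; lia.
  + case: ifP => // _ /mapP[k _ ->] /=; rewrite stLQ; split => //.
    by rewrite mulr_ge0 ?exprn_ge0 ?subr_ge0// ltW.
  + case: ifP => // _ /mapP[k _ ->] /=; rewrite stRQ_eq; split => //.
    by rewrite mulr_ge0 ?exprn_ge0 ?subr_ge0// ltW.
Qed.

Lemma rate_ge0 x y : 0 <= rate x y.
Proof.
by rewrite /Defs.rate big_seq_cond; apply: sumr_ge0 => t /andP[/transitions_valid[]].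
Qed.

Lemma outflowE (p : state -> R) x : (forall y, 0 <= p y) ->
  \esum_(y in [set~ x]) (p x * rate x y)%:E =
  (p x * \sum_(t <- trans x) t.2)%:E.
Proof.
move=> p0; rewrite mulr_sumr -(@esum_tagged _ _ (fun=> p x) x)// => t.
exact: transitions_valid.
Qed.

Lemma inflowE (p : state -> R) x : (forall y, 0 <= p y) ->
  \esum_(y in [set~ x]) (p y * rate y x)%:E =
  (\sum_(t <- sources x) p t.1 * t.2)%:E.
Proof.
move=> p0; rewrite -(@esum_tagged _ _ p x)// => [|t /sources_valid//].
by apply: eq_esum => y _; rewrite rate_sources.
Qed.

Lemma rate_gt0 x y r : (y, r) \in trans x -> 0 < r -> 0 < rate x y.
Proof.
move=> xy r0; rewrite /Defs.rate big_mkcond (big_rem _ xy) /= eqxx.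
rewrite ltr_wpDr// big_seq; apply: sumr_ge0 => t /mem_rem /transitions_valid[_].
by case: ifP.
Qed.

(** Services of the head remove the known and then the unknown units of a side; from [stQ i j],
    supply units are removed until [stR j 0]. *)
Lemma leads_to_E x : leads_to rate stE x.
Proof.
have step y r z : (y, r) \in trans z -> 0 < r -> leads_to rate stE y ->
    leads_to rate stE z.
  move=> yz r0; apply: leads_to_step; first by have [] := transitions_valid yz.
  exact: rate_gt0 yz r0.
have L m n : leads_to rate stE (stL m n).
  elim: m n => [|m IH] n.
    elim: n => [|n IH]; first by rewrite stL00; exact: leads_to_refl.
    apply: step hm2 IH; rewrite transitionsL// /side_transitions /=.
    by rewrite !inE eqxx !orbT.
  apply: (step _ (m2 + m.+1%:R * ts)) (IH n); last first.
    by rewrite addr_gt0// mulr_gt0// ltr0n.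
  by rewrite transitionsL// /side_transitions /= !inE eqxx !orbT.
have R' m n : leads_to rate stE (stR m n).
  elim: m n => [|m IH] n.
    elim: n => [|n IH]; first by rewrite stR00; exact: leads_to_refl.
    apply: step hl1 IH; rewrite transitionsR// /side_transitions /=.
    by rewrite !inE eqxx !orbT.
  apply: (step _ (l1 + m.+1%:R * td)) (IH n); last first.
    by rewrite addr_gt0// mulr_gt0// ltr0n.
  by rewrite transitionsR// /side_transitions /= !inE eqxx !orbT.
elim/state_case: x => [|m n _|m n _|i j] //; first exact: leads_to_refl.
elim: i => [|i IH].
  apply: (step (stR j.+1 0) (m2 + 1%:R * ts)) => //; last by rewrite mul1r addr_gt0.
  by rewrite transitionsQ !inE eqxx !orbT.
apply: (step _ (m2 + i.+2%:R * ts)) IH; last by rewrite addr_gt0// mulr_gt0// ltr0n.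
by rewrite transitionsQ !inE eqxx !orbT.
Qed.

(** * Balance equations for the product weights *)

Definition weight (x : state) : R :=
  match val x with
  | SEmpty => 1
  | SL m n => side_weight (l1 + l2) m1 m2 l2 ts m n
  | SR m n => side_weight (m1 + m2) l2 l1 m1 td m n
  | SQ i j => rate_prod l2 m2 ts i * rate_prod m1 l1 td j
  end.

Lemma weightE : weight stE = 1. Proof. by []. Qed.

(** Covers (0,0) as well, where all products are empty, so flows to and from the empty state obey
    the general formulas. *)
Lemma weightL m n : weight (stL m n) = side_weight (l1 + l2) m1 m2 l2 ts m n.
Proof.
have [mn0|] := boolP (0 < m + n)%N; first by rewrite /weight val_stL.
case: m n => [|m] [|n] // _.
by rewrite stL00 weightE /side_weight eqxx !rate_prod0 !mulr1.
Qed.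

Lemma weightR m n : weight (stR m n) = side_weight (m1 + m2) l2 l1 m1 td m n.
Proof.
have [mn0|] := boolP (0 < m + n)%N; first by rewrite /weight val_stR.
case: m n => [|m] [|n] // _.
by rewrite stR00 weightE /side_weight eqxx !rate_prod0 !mulr1.
Qed.

Lemma weightQ i j : weight (stQ i.+1 j.+1) =
  rate_prod l2 m2 ts i.+1 * rate_prod m1 l1 td j.+1.
Proof. by rewrite /weight val_stQ. Qed.

Let lam0 : 0 < l1 + l2. Proof. exact: addr_gt0. Qed.
Let mu0 : 0 < m1 + m2. Proof. exact: addr_gt0. Qed.

Lemma weight_gt0 x : 0 < weight x.
Proof.
elim/state_case: x => [|m n _|m n _|i j].
- by rewrite weightE.
- by rewrite weightL side_weight_gt0.
- by rewrite weightR side_weight_gt0.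
- by rewrite weightQ mulr_gt0 ?rate_prod_gt0.
Qed.

Let departL m n : \sum_(t <- side_departures stL m1 m2 gs ts m n) weight t.1 * t.2 =
  (l1 + l2) * weight (stL m n).
Proof. by rewrite weightL (side_departures_balance lam0 hm1 hm2 hts _ weightL). Qed.

Let departR m n : \sum_(t <- side_departures stR l2 l1 gd td m n) weight t.1 * t.2 =
  (m1 + m2) * weight (stR m n).
Proof.
by rewrite weightR (side_departures_balance mu0 hl2 hl1 htd _ weightR)// addrC.
Qed.

(** For [n = 0] the inflow comes from [stQ m 1] and equals [m1 * rate_prod l2 m2 ts m]; dividing it
    by the outflow rate produces the first factor of the weight. *)
Let arriveL m n : (0 < m + n)%N ->
  \sum_(t <- (if (0 < n)%N then [:: (stL m n.-1, l1 + l2)]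
               else [:: (stQ m 1, l1 + td)])) weight t.1 * t.2 =
  weight (stL m n) * (m1 + m2 + (m + n)%:R * ts).
Proof.
case: n => [|n] mn0 /=; last first.
  by rewrite big_seq1 /= !weightL side_weightS// mulrC.
case: m mn0 => // m _; rewrite big_seq1 /= weightQ weightL side_weight_pos.
rewrite rate_prod0 [rate_prod m1 _ _ _]rate_prodS rate_prod0 addn0 !mul1r mulr1.
have /lt0r_neq0 : 0 < m1 + m2 + m.+1%:R * ts by exact: den_gt0.
have /lt0r_neq0 : 0 < l1 + td by exact: addr_gt0.
move: (l1 + td) (m1 + m2 + _) => d e d0 e0.
by field; rewrite d0 e0.
Qed.

Let arriveR m n : (0 < m + n)%N ->
  \sum_(t <- (if (0 < n)%N then [:: (stR m n.-1, m1 + m2)]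
               else [:: (stQ 1 m, m2 + ts)])) weight t.1 * t.2 =
  weight (stR m n) * (l2 + l1 + (m + n)%:R * td).
Proof.
case: n => [|n] mn0 /=; last first.
  by rewrite big_seq1 /= !weightR side_weightS// mulrC.
case: m mn0 => // m _; rewrite big_seq1 /= weightQ weightR side_weight_pos.
rewrite rate_prod0 [rate_prod l2 _ _ _]rate_prodS rate_prod0 addn0 !mul1r mulr1.
have /lt0r_neq0 : 0 < l2 + l1 + m.+1%:R * td.
  by apply: den_gt0 => //; exact: addr_gt0.
have /lt0r_neq0 : 0 < m2 + ts by exact: addr_gt0.
move: (m2 + ts) (l2 + l1 + _) => d e d0 e0.
by field; rewrite d0 e0.
Qed.

Let weightQSl i j :
  weight (stQ i.+2 j.+1) * (m2 + i.+2%:R * ts) = l2 * weight (stQ i.+1 j.+1).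
Proof.
rewrite !weightQ [rate_prod _ _ _ i.+2]rate_prodS.
have /lt0r_neq0 : 0 < m2 + i.+2%:R * ts by exact: den_gt0.
by move: (m2 + _) => d d0; field.
Qed.

Let weightQSr i j :
  weight (stQ i.+1 j.+2) * (l1 + j.+2%:R * td) = m1 * weight (stQ i.+1 j.+1).
Proof.
rewrite !weightQ [rate_prod _ _ _ j.+2]rate_prodS.
have /lt0r_neq0 : 0 < l1 + j.+2%:R * td by exact: den_gt0.
by move: (l1 + _) => d d0; field.
Qed.

(** At [i = 0] the one-sided demand states stand in for the missing neighbour without supply,
    through [side_blocks_balance]. *)
Let supply_into_Q i j :
  \sum_(t <- (if (1 < i.+1)%N then [:: (stQ i j.+1, l2)] else [::]))
    weight t.1 * t.2 +
  \sum_(t <- (if i.+1 == 1%N then side_blocks stR l2 gd j.+1 else [::]))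
    weight t.1 * t.2 = weight (stQ i.+1 j.+1) * (m2 + i.+1%:R * ts).
Proof.
case: i => [|i]; last by rewrite /= big_seq1 big_nil addr0 weightQSl mulrC.
rewrite [X in X + _]big_nil add0r.
rewrite [LHS](side_blocks_balance mu0 hl2 hl1 htd _ weightR); last exact: addrC.
rewrite weightQ [rate_prod l2 _ _ _]rate_prodS rate_prod0 mul1r.
have /lt0r_neq0 : 0 < m2 + 1%:R * ts by exact: den_gt0.
by move: (m2 + _) => d d0; field.
Qed.

Let demand_into_Q i j :
  \sum_(t <- (if (1 < j.+1)%N then [:: (stQ i.+1 j, m1)] else [::]))
    weight t.1 * t.2 +
  \sum_(t <- (if j.+1 == 1%N then side_blocks stL m1 gs i.+1 else [::]))
    weight t.1 * t.2 = weight (stQ i.+1 j.+1) * (l1 + j.+1%:R * td).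
Proof.
case: j => [|j]; last by rewrite /= big_seq1 big_nil addr0 weightQSr mulrC.
rewrite [X in X + _]big_nil add0r.
rewrite [LHS](side_blocks_balance lam0 hm1 hm2 hts _ weightL)//.
rewrite weightQ [rate_prod m1 _ _ _]rate_prodS rate_prod0 mul1r.
have /lt0r_neq0 : 0 < l1 + 1%:R * td by exact: den_gt0.
by move: (l1 + _) => d d0; field.
Qed.

Lemma weight_balance x :
  weight x * \sum_(t <- trans x) t.2 = \sum_(t <- sources x) weight t.1 * t.2.
Proof.
elim/state_case: x => [|m n mn0|m n mn0|i j].
- rewrite sourcesE big_cat /= departL departR stL00 stR00 weightE !big_cons big_nil.
  by rewrite /= mul1r !mulr1 addr0.
- rewrite transitionsL// side_total_rate /sources val_stL// big_cat arriveL//.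
  by rewrite departL /=; ring.
- rewrite transitionsR// side_total_rate /sources val_stR// big_cat arriveR//.
  by rewrite departR /=; ring.
- rewrite transitionsQ /transQ !big_cons big_nil /sources val_stQ//.
  have := supply_into_Q i j; have := demand_into_Q i j.
  rewrite !big_cat !big_seq1 [(stQ i.+2 _, _).1]/= [(stQ _ j.+2, _).1]/=.
  rewrite weightQSl weightQSr.
  set A := \sum_(t <- _) _; set B := \sum_(t <- _) _ => AB.
  set C := \sum_(t <- _) _; set E := \sum_(t <- _) _ => CE /=.
  (* The outflows at rates [l2] and [m1] are returned by [stQ i.+2 j.+1] and [stQ i.+1 j.+2];
     [C + E] and [A + B] balance the departures of supply and of demand. *)
  transitivity (l2 * weight (stQ i.+1 j.+1) + m1 * weight (stQ i.+1 j.+1) +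
      (C + E) + (A + B)).
    by rewrite CE AB; ring.
  ring.
Qed.

(** * Summability of the total flow *)

Let tot := l1 + l2 + m1 + m2 + ts + td.
(** Dominates [x / ts] and [x / td] whenever 0 <= [x] <= [tot], so one exponential series majorizes
    all four kinds of weights. *)
Let z := tot / ts + tot / td.

(* [lra] ignores section hypotheses unless they are copied. *)
Ltac copy_hyps := move: hl1 hl2 hm1 hm2 hts htd => ? ? ? ? ? ?.
Ltac pos_lra := rewrite /tot; copy_hyps; lra.
Ltac pos_nra := copy_hyps; nra.

(** Injects the states into triples, over which the majorant is a product of three series; the first
    component tags the kind. *)
Definition shape (x : state) : nat * (nat * nat) :=
  match val x with
  | SEmpty => (0, (0, 0))%N
  | SL m n => (1, (m, n))%N
  | SR m n => (2, (m, n))%N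
  | SQ i j => (3, (i, j))%N
  end.

Lemma shape_inj : injective shape.
Proof.
move=> x y; rewrite /shape => xy; apply: val_inj; move: xy.
by case: (val x) => [|m n|m n|m n]; case: (val y) => [|m' n'|m' n'|m' n'] 
  => // -[e1 e2]; rewrite ?e1 ?e2.
Qed.

Let ratio_le (x s : R) : 0 <= x <= tot -> s = ts \/ s = td -> x / s <= z.
Proof.
move=> /andP[x0 xt] sE.
have s0 : 0 < s by case: sE => ->.
apply: (@le_trans _ _ (tot / s)); first by rewrite ler_wpM2r ?invr_ge0 ?(ltW s0).
have t0 r : 0 < r -> 0 <= tot / r.
  by move=> r0; apply: divr_ge0; [exact: le_trans xt|exact: ltW].
by case: sE => ->; rewrite /z ?lerDl ?lerDr t0.
Qed.

Let side_weight_le (lam a b c s : R) m n : 0 < a -> 0 < b -> 0 <= lam <= tot ->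
  0 <= c <= tot -> s = ts \/ s = td ->
  side_weight lam a b c s m n <= exp_coeff z m * exp_coeff z n.
Proof.
move=> a0 b0 lt ct sE; have s0 : 0 < s by case: sE => ->.
have [/andP[lam_ge0 _] /andP[c_ge0 _]] := (lt, ct).
have ab0 : 0 < a + b + m%:R * s by rewrite den_gt0// addr_gt0.
have prod0 x y k : 0 <= x -> 0 < y -> 0 <= rate_prod x y s k.
  move=> x0 y0; apply: prodr_ge0 => i _.
  by rewrite divr_ge0// ltW// den_gt0.
rewrite /side_weight ler_pM ?prod0//.
- by rewrite mulr_ge0 ?prod0//; case: ifP => // _; rewrite divr_ge0 ?ltW.
- rewrite -[leRHS]mul1r ler_pM ?prod0//.
  + by case: ifP => // _; rewrite divr_ge0 ?ltW.
  + case: ifP => // _; rewrite ler_pdivrMr// mul1r -addrA lerDl.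
    by rewrite ltW// den_gt0.
  + by apply: rate_prod_le => //; exact: ratio_le.
- by apply: rate_prod_le => //; exact: ratio_le.
Qed.

Lemma weight_le x :
  weight x <= exp_coeff z (shape x).2.1 * exp_coeff z (shape x).2.2.
Proof.
have bounds (y : R) : 0 <= y -> y <= tot -> 0 <= y <= tot by move=> -> ->.
elim/state_case: x => [|m n mn0|m n mn0|i j].
- by rewrite weightE /exp_coeff /= expr0 fact0 divr1 mulr1.
- rewrite weightL /shape val_stL//; apply: side_weight_le => //; try by left.
    by apply/andP; split; pos_lra.
  by apply/andP; split; pos_lra.
- rewrite weightR /shape val_stR//; apply: side_weight_le => //; try by right.
    by apply/andP; split; pos_lra.
  by apply/andP; split; pos_lra.
- rewrite weightQ /shape val_stQ//; apply: ler_pM.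
  + by apply/ltW/rate_prod_gt0.
  + by apply/ltW/rate_prod_gt0.
  + apply: rate_prod_le => //; first exact: ltW.
    by apply: ratio_le; [apply/andP; split; pos_lra|left].
  + apply: rate_prod_le => //; first exact: ltW.
    by apply: ratio_le; [apply/andP; split; pos_lra|right].
Qed.

(** Linear growth is relaxed to powers of 2, which keep the product structure and are absorbed into
    [exp_coeff (2 * z)]. *)
Lemma total_rate_le x :
  \sum_(t <- trans x) t.2 <= tot * (2 ^+ (shape x).2.1 * 2 ^+ (shape x).2.2).
Proof.
have tot0 : 0 <= tot by pos_lra.
have pow m n : (1 + m + n)%:R <= 2 ^+ m * 2 ^+ n :> R.
  rewrite -!natrX -natrM ler_nat.
  have := ltn_expl m (ltnSn 1); have := ltn_expl n (ltnSn 1).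
  by move: (2 ^ m)%N (2 ^ n)%N => u v; nia.
elim/state_case: x => [|m n mn0|m n mn0|i j].
- by rewrite /= !big_cons big_nil /= !expr0 !mulr1; pos_lra.
- rewrite transitionsL// side_total_rate /shape val_stL//=.
  apply: le_trans (ler_wpM2l tot0 (pow m n)).
  have m0 : 0 <= m%:R :> R by []. have n0 : 0 <= n%:R :> R by [].
  by rewrite !natrD /tot; pos_nra.
- rewrite transitionsR// side_total_rate /shape val_stR//=.
  apply: le_trans (ler_wpM2l tot0 (pow m n)).
  have m0 : 0 <= m%:R :> R by []. have n0 : 0 <= n%:R :> R by [].
  by rewrite !natrD /tot; pos_nra.
- rewrite transitionsQ /transQ /shape val_stQ// !big_cons big_nil.
  apply: le_trans (ler_wpM2l tot0 (pow i.+1 j.+1)).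
  have i0 : 0 <= i.+1%:R :> R by []. have j0 : 0 <= j.+1%:R :> R by [].
  by rewrite !natrD /tot /=; pos_nra.
Qed.

Lemma weight_rate_summable :
  (\esum_(x in [set: state]) (weight x * \sum_(t <- trans x) t.2)%:E < +oo)%E.
Proof.
have tot0 : 0 <= tot by pos_lra.
have z0 : 0 <= 2 * z.
  by rewrite mulr_ge0// addr_ge0//; apply: divr_ge0 => //; exact: ltW.
pose e := exp_coeff (2 * z).
have e0 n : 0 <= e n by exact: exp_coeff_ge0.
have f0 n : 0 <= exp_coeff (1 : R) n by exact: exp_coeff_ge0.
pose g (u : nat * (nat * nat)) : R := exp_coeff 1 u.1 * (e u.2.1 * e u.2.2).
have g0 u : 0 <= g u by apply: mulr_ge0; [exact: f0|apply: mulr_ge0; exact: e0].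
have c0 : 0 <= tot * 6 by exact: mulr_ge0.
have gfin : (\esum_(u in [set: nat * (nat * nat)]) (g u)%:E < +oo)%E.
  apply: (esum_prod_lty (f := exp_coeff 1) (g := fun v => e v.1 * e v.2)) => //.
  - by move=> v; rewrite mulr_ge0.
  - exact: esum_exp_coeff_lty.
  - by apply: esum_prod_lty => //; exact: esum_exp_coeff_lty.
apply: (@le_lt_trans _ _ (\esum_(u in [set: nat * (nat * nat)])
    ((tot * 6)%:E * (g u)%:E))%E).
  apply: (le_esum_inj shape_inj) => [u|x].
    by rewrite -EFinM lee_fin; apply: mulr_ge0; [exact: c0|exact: g0].
  rewrite -EFinM lee_fin.
  (* The tag [k] is at most 3 and [exp_coeff 1 k] is 1/k!, whence the constant 6 = 3!. *)
  have kind : 1 <= 6 * exp_coeff 1 (shape x).1 :> R.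
    rewrite /shape /exp_coeff; case: (val x) => [|? ?|? ?|? ?] /=;
      by rewrite expr1n ?factS fact0 //; lra.
  have tr0 : 0 <= \sum_(t <- trans x) t.2.
    by rewrite big_seq; apply: sumr_ge0 => t /transitions_valid[].
  apply: (le_trans (ler_pM (ltW (weight_gt0 x)) tr0 (weight_le x)
    (total_rate_le x))).
  rewrite /g /e; move: kind; move: (shape x) => [k [m n]] /= kind.
  have eE i : exp_coeff (2 * z) i = 2 ^+ i * exp_coeff z i.
    by rewrite /exp_coeff /= exprMn mulrA.
  have -> : exp_coeff z m * exp_coeff z n * (tot * (2 ^+ m * 2 ^+ n)) =
      tot * (exp_coeff (2 * z) m * exp_coeff (2 * z) n).
    by rewrite !eE; ring.
  rewrite -[X in _ <= X]mulrA ler_wpM2l// [X in _ <= X]mulrA ler_peMl//.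
  by apply: mulr_ge0; exact: e0.
rewrite esumZl; last 2 first.
- exact: c0.
- by move=> u; rewrite lee_fin; exact: g0.
by rewrite lte_mul_pinfty.
Qed.

(** The arrival of a flexible supply unit changes every state. This lower bound turns summability of
    the flow into summability of the weights. *)
Lemma total_rate_ge x : l1 <= \sum_(t <- trans x) t.2.
Proof.
elim/state_case: x => [|m n mn0|m n mn0|i j].
- by rewrite !big_cons big_nil /=; pos_lra.
- have := ler0n R (m + n); rewrite transitionsL// side_total_rate; pos_nra.
- have := ler0n R (m + n); rewrite transitionsR// side_total_rate; pos_nra.
- have := ler0n R i.+1; have := ler0n R j.+1.
  by rewrite transitionsQ !big_cons big_nil /=; pos_nra.
Qed.

Let weight_ge0 x : 0 <= weight x. Proof. exact/ltW/weight_gt0. Qed.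

Lemma weight_summable : (\esum_(x in [set: state]) (weight x)%:E < +oo)%E.
Proof.
have rate0 x : 0 <= \sum_(t <- trans x) t.2.
  exact: le_trans (ltW hl1) (total_rate_ge x).
have l10 : 0 <= l1^-1 by rewrite invr_ge0 ltW.
apply: (@le_lt_trans _ _ (\esum_(x in [set: state])
    (l1^-1%:E * (weight x * \sum_(t <- trans x) t.2)%:E))%E).
  apply: le_esum => x _; rewrite -EFinM lee_fin mulrCA ler_peMr//.
  by rewrite -(mulVf (lt0r_neq0 hl1)) ler_wpM2l// total_rate_ge.
rewrite esumZl//; last by move=> x; rewrite lee_fin mulr_ge0.
by rewrite lte_mul_pinfty// weight_rate_summable.
Qed.

(** * Normalization and uniqueness *)

Let partition : R := fine (\esum_(x in [set: state]) (weight x)%:E)%E.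

Let partitionE : (\esum_(x in [set: state]) (weight x)%:E)%E = partition%:E.
Proof.
rewrite /partition fineK// ge0_fin_numE ?weight_summable//.
by apply: esum_ge0 => x _; rewrite lee_fin.
Qed.

Let partition_gt0 : 0 < partition.
Proof.
rewrite -lte_fin -partitionE; apply: (@lt_le_trans _ _ 1%:E).
  by rewrite lte_fin.
rewrite (esumID [set stE]); last by move=> x _; rewrite lee_fin.
rewrite setTI esum_set1 ?lee_fin// leeDl// esum_ge0// => x _.
by rewrite lee_fin.
Qed.

Let scaled_total c : 0 <= c ->
  (\esum_(x in [set: state]) (c * weight x)%:E = (c * partition)%:E)%E.
Proof.
by move=> c0; rewrite EFinM -partitionE -esumZl//.
Qed.

Lemma weight_global_balance c : 0 <= c ->
  global_balance rate (fun x => c * weight x).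
Proof.
move=> c0 x; have cw0 y : 0 <= c * weight y by exact: mulr_ge0.
rewrite (outflowE (p := fun x => c * weight x))//.
rewrite (inflowE (p := fun x => c * weight x))//.
rewrite -mulrA weight_balance mulr_sumr; congr EFin.
by apply: eq_bigr => t _; rewrite mulrA.
Qed.

Lemma steady_state_weight : steady_state rate (fun x => partition^-1 * weight x).
Proof.
have c0 : 0 <= partition^-1 by rewrite invr_ge0 ltW.
split; last exact: weight_global_balance.
split=> [x|]; first by rewrite mulr_ge0.
by rewrite scaled_total// mulVf// gt_eqF.
Qed.

(** The comparison is anchored at [stE], where the weight is 1; hence the constant is the
    probability of the empty system. *)
Lemma steady_stateE p : steady_state rate p -> forall x, p x = p stE * weight x.
Proof.
move=> [[p0 _] balp] x.
have balw : global_balance rate weight.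
  have := weight_global_balance ler01.
  by under [X in global_balance _ X]funext do rewrite mul1r.
rewrite (global_balance_proportional rate_ge0 weight_gt0 balw _ leads_to_E p0 balp x).
  by rewrite weightE divr1.
under eq_esum do rewrite outflowE//.
exact: weight_rate_summable.
Qed.

Lemma steady_state_unique : exists! p, steady_state rate p.
Proof.
exists (fun x => partition^-1 * weight x); split; first exact: steady_state_weight.
move=> p sp; have pE := steady_stateE sp.
have [[p0 ptot] _] := sp.
apply/funext => x; rewrite pE; congr (_ * _).
(* Total mass 1 forces the constant to be the inverse of [partition]. *)
have : p stE * partition = 1.
  apply: EFin_inj; rewrite -scaled_total// -ptot.
  by apply: eq_esum => y _; rewrite [in RHS]pE.
by move=> pZ; apply: (mulIf (lt0r_neq0 partition_gt0)); rewrite pZ mulVf// gt_eqF.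
Qed.


End NSystem.

Theorem theorem2 (R : realType) (l1 l2 m1 m2 ts td : R)
  (hl1 : 0 < l1) (hl2 : 0 < l2) (hm1 : 0 < m1) (hm2 : 0 < m2)
  (hts : 0 < ts) (htd : 0 < td) :
  (exists! p : state -> R, steady_state (rate l1 l2 m1 m2 ts td) p) /\
  forall p : state -> R, steady_state (rate l1 l2 m1 m2 ts td) p ->
  exists B : R,
    [/\ B = p stE,
        forall i j : nat, (1 <= i)%N -> (1 <= j)%N ->
          p (stQ i j) =
          (\prod_(1 <= k < i.+1) (l2 / (m2 + k%:R * ts))) *
          (\prod_(1 <= k < j.+1) (m1 / (l1 + k%:R * td))) * B,
        (forall m n : nat, (1 <= m)%N ->
          p (stL m n) =
          (m1 / (m1 + m2 + m%:R * ts)) *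
          (\prod_(1 <= i < m.+1) (l2 / (m2 + i%:R * ts))) *
          (\prod_(1 <= i < n.+1)
             ((l1 + l2) / (m1 + m2 + m%:R * ts + i%:R * ts))) * B) /\
        (forall n : nat, (0 < n)%N ->
          p (stL 0 n) =
          (\prod_(1 <= i < n.+1)
             ((l1 + l2) / (m1 + m2 + i%:R * ts))) * B)
      & (forall m n : nat, (1 <= m)%N ->
          p (stR m n) =
          (l2 / (l1 + l2 + m%:R * td)) *
          (\prod_(1 <= i < m.+1) (m1 / (l1 + i%:R * td))) *
          (\prod_(1 <= i < n.+1)
             ((m1 + m2) / (l1 + l2 + m%:R * td + i%:R * td))) * B) /\
        (forall n : nat, (0 < n)%N ->
          p (stR 0 n) =
          (\prod_(1 <= i < n.+1)
             ((m1 + m2) / (l1 + l2 + i%:R * td))) * B)].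
Proof.
split; first exact: steady_state_unique.
move=> p sp; have pE x := steady_stateE hl1 hl2 hm1 hm2 hts htd sp x.
exists (p stE); split=> //.
- by move=> [|i] [|j] // _ _; rewrite pE weightQ mulrC.
- split=> [[|m] n // _|n _]; first by rewrite pE weightL mulrC.
  by rewrite pE weightL side_weight0 mul0r addr0 mulrC.
(* On the demand side [a] is [l2] and [b] is [l1], so the denominators in [weightR] start with
   [l2 + l1]. *)
- rewrite (addrC l1); split=> [[|m] n // _|n _]; first by rewrite pE weightR mulrC.
  by rewrite pE weightR side_weight0 mul0r addr0 mulrC.
Qed.
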